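(* Let $M$ be a Riemann surface (equipped with a compatible Riemannian metric and a fixed spin structure) and $N$ a Riemannian manifold. Assume $\phi:M\to N$ is a harmonic map and $\Psi\in\Gamma(\Sigma M)$ is a twistor spinor. Define a spinor field $\psi_{\phi,\Psi}\in\Gamma(\Sigma M\otimes\phi^{-1}TN)$ along the map $\phi$ by $$\psi_{\phi,\Psi}:=\sum_{\alpha}\epsilon_\alpha\cdot\Psi\otimes\phi_*(\epsilon_\alpha),$$ where $\epsilon_\alpha$ ($\alpha=1,2$) is a local orthonormal basis of $M$. Then $(\phi,\psi_{\phi,\Psi})$ is a Dirac-harmonic map.
   Context: $(M,g)$ is a Riemannian manifold of dimension $n$ (here $n=2$) with fixed spin structure; $\Sigma M$ is its (complex) spinor bundle with its Hermitian metric $\langle\cdot,\cdot\rangle$, spin connection $\nabla$ and Clifford multiplication, satisfying $\langle X\cdot\xi,\eta\rangle=-\langle\xi,X\cdot\eta\rangle$ and $X\cdot Y\cdot\xi+Y\cdot X\cdot\xi=-2g(X,Y)\xi$. The usual Dirac operator is ${\partial\!\!\!/}\xi=\sum_\alpha\epsilon_\alpha\cdot\nabla_{\epsilon_\alpha}\xi$ for a local orthonormal frame. A spinor $\Psi$ is a twistor spinor if $\nabla_X\Psi+\frac1n X\cdot{\partial\!\!\!/}\Psi=0$ for all $X\in\Gamma(TM)$. For a smooth map $\phi:(M,g)\to(N,h)$, the bundle $\Sigma M\otimes\phi^{-1}TN$ carries the connection $\tilde\nabla$ induced by those on $\Sigma M$ and $\phi^{-1}TN$, and the Dirac operator along $\phi$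 is ${D\!\!\!\!/}\psi=\sum_\alpha\epsilon_\alpha\cdot\tilde\nabla_{\epsilon_\alpha}\psi$. In local coordinates $y^i$ on $N$ write $\psi=\psi^i\otimes\frac{\partial}{\partial y^i}$, let $\nabla\phi^i$ be the gradient of $\phi^i=y^i\circ\phi$, let $R\left(\frac{\partial}{\partial y^k},\frac{\partial}{\partial y^l}\right)\frac{\partial}{\partial y^j}=R^i{}_{jkl}\frac{\partial}{\partial y^i}$ be the curvature of $N$ (evaluated along $\phi$), and set $\mathcal R(\phi,\psi)=\frac12R^i{}_{jkl}\langle\psi^k,\nabla\phi^j\cdot\psi^l\rangle\frac{\partial}{\partial y^i}$ (summation convention). With $\tau(\phi)=\mathrm{trace}\,\nabla d\phi$ the tension field, $(\phi,\psi)$ is called a Dirac-harmonic map if $\tau(\phi)=\mathcal R(\phi,\psi)$ and ${D\!\!\!\!/}\psi=0$; $\phi$ is harmonic if $\tau(\phi)=0$. *)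

(* Defs.v *)
From HB Require Import structures.
From mathcomp Require Import all_boot all_order all_algebra.
From mathcomp Require Import boolp classical_sets functions reals.
From mathcomp Require Import topology normedtype derive.
From mathcomp Require Import complex ring.
Import Order.TTheory GRing.Theory Num.Theory.
Import numFieldNormedType.Exports.
Set Implicit Arguments.
Unset Strict Implicit.
Unset Printing Implicit Defensive.
Local Open Scope classical_set_scope.
Local Open Scope ring_scope.
Local Open Scope complex_scope.

Definition partial (R : realType) (n : nat) (i : 'I_n) (f : 'rV[R]_n -> R)
    (x : 'rV[R]_n) : R :=
  'D_(delta_mx 0 i) f x.

(* For open A this is C^oo regularity: every iterated partial derivative of f
   is differentiable on A. *)
Definition smooth_on (R : realType) (n : nat) (A : set 'rV[R]_n)
    (f : 'rV[R]_n -> R) : Prop :=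
  forall (s : seq 'I_n) (x : 'rV[R]_n), A x ->
    differentiable (foldr (@partial R n) f s) x.

(* Only the values of cmap on cdom, and of cinv on the image of cdom, are
   meaningful. *)
Record chart (R : realType) (n : nat) (T : topologicalType) : Type := Chart {
  cdom : set T;
  cmap :> T -> 'rV[R]_n;
  cinv : 'rV[R]_n -> T;
  cdom_open : open cdom;
  cimg_open : open (cmap @` cdom);
  cmapK : forall p, cdom p -> cinv (cmap p) = p;
  cmap_cont : forall p, cdom p -> {for p, continuous cmap};
  cinv_cont : forall x, (cmap @` cdom) x -> {for x, continuous cinv} }.

Section ChartCalculus.
Variables (R : realType) (n : nat) (T : topologicalType) (c : chart R n T).

Definition chart_coord (i : 'I_n) (p : T) : R := c p 0 i.

Definition pd (i : 'I_n) (f : T -> R) (p : T) : R :=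
  partial i (f \o cinv c) (c p).

(* Differentiation along the tangent vector X = \sum_i X^i d/dx^i. *)
Definition dvec (X : 'rV[R]_n) (f : T -> R) (p : T) : R :=
  \sum_i X 0 i * pd i f p.

Definition smooth_in (U : set T) (f : T -> R) : Prop :=
  smooth_on (c @` U) (f \o cinv c).

Definition smooth_inC (U : set T) (f : T -> R[i]) : Prop :=
  smooth_in U (fun p => complex.Re (f p)) /\
  smooth_in U (fun p => complex.Im (f p)).

End ChartCalculus.

(* Entry (i, j) is the derivative of the j-th coordinate of c' along d/dx^i of
   c, so the row X of components of a tangent vector in c becomes
   X *m jacobian c c' p in c'. *)
Definition jacobian (R : realType) (n : nat) (T : topologicalType)
    (c c' : chart R n T) (p : T) : 'M[R]_n :=
  \matrix_(i, j) pd c i (chart_coord c' j) p.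

(* Connectedness is not required. *)
Record manifold (R : realType) (n : nat) : Type := Manifold {
  mspace :> topologicalType;
  mhausdorff : hausdorff_space mspace;
  mcountable : @second_countable mspace;
  mindex : Type;
  matlas : mindex -> chart R n mspace;
  mcover : forall p, exists c, cdom (matlas c) p;
  msmooth : forall c c' i,
    smooth_in (matlas c) (cdom (matlas c) `&` cdom (matlas c'))
      (chart_coord (matlas c') i) }.

(* metric c p is the Gram matrix of the coordinate fields of the chart c. *)
Record riemannian_manifold (R : realType) (n : nat) : Type :=
  RiemannianManifold {
  rmanifold :> manifold R n;
  metric : mindex rmanifold -> rmanifold -> 'M[R]_n;
  metric_smooth : forall c i j,
    smooth_in (matlas c) (cdom (matlas c)) (fun p => metric c p i j);
  metric_sym : forall c p, cdom (matlas c) p -> (metric c p)^T = metric c p;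
  metric_pos : forall c p, cdom (matlas c) p ->
    forall v : 'rV[R]_n, v != 0 -> 0 < (v *m metric c p *m v^T) 0 0;
  metric_change : forall c c' p,
    cdom (matlas c) p -> cdom (matlas c') p ->
    metric c p = jacobian (matlas c) (matlas c') p *m metric c' p
                 *m (jacobian (matlas c) (matlas c') p)^T }.

Section LeviCivita.
Variables (R : realType) (n : nat) (M : riemannian_manifold R n).
Variable c : mindex M.

Definition inner (X Y : 'rV[R]_n) (p : M) : R :=
  (X *m metric c p *m Y^T) 0 0.

(* Christoffel symbol Gamma^k_ij. *)
Definition christoffel (k i j : 'I_n) (p : M) : R :=
  2^-1 * \sum_l invmx (metric c p) k l *
    (pd (matlas c) i (fun q => metric c q j l) p
     + pd (matlas c) j (fun q => metric c q i l) p
     - pd (matlas c) l (fun q => metric c q i j) p).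

Definition nabla_vec (X : 'rV[R]_n) (Y : M -> 'rV[R]_n) (p : M) : 'rV[R]_n :=
  \row_k (dvec (matlas c) X (fun q => Y q 0 k) p
          + \sum_i \sum_j christoffel k i j p * X 0 i * Y p 0 j).

(* R^i_jkl, where R(d_k, d_l) d_j = R^i_jkl d_i and
   R(X, Y) = [nabla_X, nabla_Y] - nabla_[X, Y]. *)
Definition curvature (i j k l : 'I_n) (p : M) : R :=
  pd (matlas c) k (christoffel i l j) p
  - pd (matlas c) l (christoffel i k j) p
  + \sum_m (christoffel i k m p * christoffel m l j p
            - christoffel i l m p * christoffel m k j p).

Definition gradient (f : M -> R) (p : M) : 'rV[R]_n :=
  \row_i \sum_j invmx (metric c p) i j * pd (matlas c) j f p.

End LeviCivita.

Section Maps.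
Variables (R : realType) (m n : nat).
Variables (M : riemannian_manifold R m) (N : riemannian_manifold R n).
Variable phi : M -> N.

(* The local expression phi^i = y^i o phi in the chart d of N. *)
Definition mapcoord (d : mindex N) (i : 'I_n) (p : M) : R :=
  chart_coord (matlas d) i (phi p).

Definition smooth_map : Prop :=
  continuous phi /\
  forall (c : mindex M) (d : mindex N) (i : 'I_n),
    smooth_in (matlas c) (cdom (matlas c) `&` phi @^-1` cdom (matlas d))
      (mapcoord d i).

(* i-th component of (nabla d phi)(d_a, d_b). *)
Definition second_fundamental_form (c : mindex M) (d : mindex N)
    (i : 'I_n) (a b : 'I_m) (p : M) : R :=
  pd (matlas c) a (pd (matlas c) b (mapcoord d i)) p
  - \sum_e christoffel c e a b p * pd (matlas c) e (mapcoord d i) p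
  + \sum_j \sum_k christoffel d i j k (phi p)
      * pd (matlas c) a (mapcoord d j) p * pd (matlas c) b (mapcoord d k) p.

Definition tension (c : mindex M) (d : mindex N) (i : 'I_n) (p : M) : R :=
  \sum_a \sum_b invmx (metric c p) a b
    * second_fundamental_form c d i a b p.

Definition harmonic_map : Prop :=
  smooth_map /\
  forall (c : mindex M) (d : mindex N) (i : 'I_n) (p : M),
    cdom (matlas c) p -> cdom (matlas d) (phi p) -> tension c d i p = 0.

End Maps.

(* The atlas is a holomorphic atlas (its transition maps satisfy the
   Cauchy-Riemann equations), and the metric is conformal in its charts. *)
Record riemann_surface (R : realType) : Type := RiemannSurface {
  rsurface :> riemannian_manifold R 2;
  rs_holomorphic : forall (c c' : mindex rsurface) (p : rsurface),
    cdom (matlas c) p -> cdom (matlas c') p ->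
    jacobian (matlas c) (matlas c') p 0 0
      = jacobian (matlas c) (matlas c') p 1 1 /\
    jacobian (matlas c) (matlas c') p 1 0
      = - jacobian (matlas c) (matlas c') p 0 1;
  rs_conformal : forall (c : mindex rsurface) (p : rsurface),
    cdom (matlas c) p -> exists lam : R, metric c p = lam%:M }.

(* Spinor representation of Cl_2 on C^2: gamma 0 = (0 1; -1 0) and
   gamma 1 = (0 i; i 0). *)
Definition gamma (R : realType) (k : 'I_2) : 'M[R[i]]_2 :=
  \matrix_(r, s) (if r == s then 0
                  else if k == 0 then (if r == 0 then 1 else - 1)
                  else 0 +i* 1).
Arguments gamma {R} k.

Definition hdot (R : realType) (x y : 'cV[R[i]]_2) : R[i] :=
  \sum_s x s 0 * (y s 0)^*.

Lemma gamma_clifford (R : realType) (k l : 'I_2) :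
  gamma k *m gamma l + gamma l *m gamma k
    = (- (2 * (k == l)%:R))%:M :> 'M[R[i]]_2.
Proof.
apply/matrixP => r s; rewrite !mxE !big_ord_recl !big_ord0 !mxE.
by case: k l r s => [[|[|//]] ?] [[|[|//]] ?] [[|[|//]] ?] [[|[|//]] ?];
  apply/eqP; rewrite eq_complex /= ?mulr1n ?mulr0n /=; apply/andP;
  split; apply/eqP; rewrite /=; ring.
Qed.

Lemma hdot_gamma (R : realType) (k : 'I_2) (x y : 'cV[R[i]]_2) :
  hdot (gamma k *m x) y = - hdot x (gamma k *m y).
Proof.
rewrite /hdot !big_ord_recl !big_ord0 !mxE !big_ord_recl !big_ord0 !mxE.
case: k => [[|[|//]] ?] /=;
  move: (x _ 0) (x _ 0) (y _ 0) (y _ 0) => [a b] [c d] [e f] [g h];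
  apply/eqP; rewrite eq_complex /=; apply/andP; split; apply/eqP; ring.
Qed.

(* Image in U(2) of Spin(2) = {a + b e_1 e_2 | a^2 + b^2 = 1}. *)
Definition spin_group (R : realType) : set 'M[R[i]]_2 :=
  [set z | exists a b : R, a ^+ 2 + b ^+ 2 = 1 /\
     z = a%:C%:M + b%:C *: (gamma 0 *m gamma 1)].

(* E stores the components of a frame in a chart, one vector per row, and G is
   the Gram matrix of the coordinate fields. *)
Definition orthonormal_frame (R : realType) (G E : 'M[R]_2) : Prop :=
  E *m G *m E^T = 1%:M.

(* Matrix of Clifford multiplication by X, in the trivialization of the spinor
   bundle determined by the orthonormal frame E. *)
Definition clifford (R : realType) (G E : 'M[R]_2) (X : 'rV[R]_2) :
    'M[R[i]]_2 :=
  \sum_k ((X *m G *m (row k E)^T) 0 0)%:C *: gamma k.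

(* A spin structure, as a lift to Spin(2) of the transition functions of the
   bundle of oriented orthonormal frames: over each member of an open cover an
   oriented orthonormal frame (written in the chart sp_chart), and over the
   overlaps Spin(2)-valued cocycles sp_trans a b covering the change from the
   frame a to the frame b.  For a vector v = \sum_k v^k e^b_k the relation
   sp_lift reads z (v^k gamma_k) z^-1 = clifford multiplication by v in the
   frame a, i.e. Ad(z) is the change of frames. *)
Record spin_structure (R : realType) (M : riemann_surface R) : Type :=
  SpinStructure {
  sp_index : Type;
  sp_chart : sp_index -> mindex M;
  sp_dom : sp_index -> set M;
  sp_frame : sp_index -> M -> 'M[R]_2;
  sp_trans : sp_index -> sp_index -> M -> 'M[R[i]]_2;
  sp_open : forall a, open (sp_dom a);
  sp_sub : forall a, sp_dom a `<=` cdom (matlas (sp_chart a));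
  sp_cover : forall p, exists a, sp_dom a p;
  sp_frame_smooth : forall a k i,
    smooth_in (matlas (sp_chart a)) (sp_dom a) (fun p => sp_frame a p k i);
  sp_frame_on : forall a p, sp_dom a p ->
    orthonormal_frame (metric (sp_chart a) p) (sp_frame a p);
  sp_frame_oriented : forall a p, sp_dom a p -> 0 < \det (sp_frame a p);
  sp_trans_smooth : forall a b r s,
    smooth_inC (matlas (sp_chart a)) (sp_dom a `&` sp_dom b)
      (fun p => sp_trans a b p r s);
  sp_trans_spin : forall a b p, sp_dom a p -> sp_dom b p ->
    spin_group (sp_trans a b p);
  sp_cocycle : forall a b c p, sp_dom a p -> sp_dom b p -> sp_dom c p ->
    sp_trans a b p *m sp_trans b c p = sp_trans a c p;
  sp_lift : forall a b p, sp_dom a p -> sp_dom b p -> forall k : 'I_2,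
    sp_trans a b p *m gamma k =
      clifford (metric (sp_chart a) p) (sp_frame a p)
        (row k (sp_frame b p)
         *m jacobian (matlas (sp_chart b)) (matlas (sp_chart a)) p)
      *m sp_trans a b p }.

Section Spinors.
Variables (R : realType) (M : riemann_surface R) (S : spin_structure M).

(* A spinor field is given by its local representatives. *)
Definition is_spinor (Psi : sp_index S -> M -> 'cV[R[i]]_2) : Prop :=
  (forall a r, smooth_inC (matlas (sp_chart a)) (sp_dom a)
                 (fun p => Psi a p r 0)) /\
  (forall a b p, sp_dom a p -> sp_dom b p ->
     Psi a p = sp_trans a b p *m Psi b p).

Section Trivialization.
Variable a : sp_index S.
Local Notation c := (sp_chart a).

Definition cliff (p : M) (X : 'rV[R]_2) : 'M[R[i]]_2 :=
  clifford (metric c p) (sp_frame a p) X.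

Definition dspinor (X : 'rV[R]_2) (xi : M -> 'cV[R[i]]_2) (p : M) :
    'cV[R[i]]_2 :=
  \col_s (dvec (matlas c) X (fun q => complex.Re (xi q s 0)) p
          +i* dvec (matlas c) X (fun q => complex.Im (xi q s 0)) p).

(* g(nabla_X e_k, e_l) for the frame e of the trivialization. *)
Definition connection_form (X : 'rV[R]_2) (k l : 'I_2) (p : M) : R :=
  inner c (nabla_vec c X (fun q => row k (sp_frame a q)) p)
    (row l (sp_frame a p)) p.

(* The spin connection, with potential
   1/4 \sum_(k, l) g(nabla_X e_k, e_l) e_k e_l. *)
Definition nabla_spin (X : 'rV[R]_2) (xi : M -> 'cV[R[i]]_2) (p : M) :
    'cV[R[i]]_2 :=
  dspinor X xi p
  + 4^-1 *: \sum_k \sum_l (connection_form X k l p)%:C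
      *: (gamma k *m gamma l *m xi p).

Definition dirac (xi : M -> 'cV[R[i]]_2) (p : M) : 'cV[R[i]]_2 :=
  \sum_k cliff p (row k (sp_frame a p))
    *m nabla_spin (row k (sp_frame a p)) xi p.

End Trivialization.

Definition twistor_spinor (Psi : sp_index S -> M -> 'cV[R[i]]_2) : Prop :=
  is_spinor Psi /\
  forall a p, sp_dom a p -> forall X : 'rV[R]_2,
    nabla_spin a X (Psi a) p
    + 2^-1 *: (cliff a p X *m dirac a (Psi a) p) = 0.

Variables (n : nat) (N : riemannian_manifold R n) (phi : M -> N).

(* Sections psi = psi^i (x) d/dy^i of the bundle Sigma M (x) phi^-1 TN:
   psi a d i represents psi^i in the spin trivialization a and the chart d
   of N. *)
Definition is_twisted_spinor
    (psi : sp_index S -> mindex N -> 'I_n -> M -> 'cV[R[i]]_2) : Prop :=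
  (forall a d i r,
     smooth_inC (matlas (sp_chart a))
       (sp_dom a `&` phi @^-1` cdom (matlas d)) (fun p => psi a d i p r 0)) /\
  (forall a a' d d' i p, sp_dom a p -> sp_dom a' p ->
     cdom (matlas d) (phi p) -> cdom (matlas d') (phi p) ->
     psi a d i p = \sum_j (jacobian (matlas d') (matlas d) (phi p) j i)%:C
       *: (sp_trans a a' p *m psi a' d' j p)).

Section LocalFormulas.
Variables (a : sp_index S) (d : mindex N) (psi : 'I_n -> M -> 'cV[R[i]]_2).
Local Notation c := (sp_chart a).

(* i-th component of the covariant derivative of psi along X. *)
Definition nabla_twisted (X : 'rV[R]_2) (i : 'I_n) (p : M) : 'cV[R[i]]_2 :=
  nabla_spin a X (psi i) p
  + \sum_j \sum_k
      (christoffel d i j k (phi p)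
       * dvec (matlas c) X (mapcoord phi d j) p)%:C *: psi k p.

Definition dirac_along (i : 'I_n) (p : M) : 'cV[R[i]]_2 :=
  \sum_k cliff a p (row k (sp_frame a p))
    *m nabla_twisted (row k (sp_frame a p)) i p.

(* i-th component of R(phi, psi), complex-valued a priori. *)
Definition curvature_term (i : 'I_n) (p : M) : R[i] :=
  2^-1 * \sum_j \sum_k \sum_l (curvature d i j k l (phi p))%:C
    * hdot (psi k p) (cliff a p (gradient c (mapcoord phi d j) p) *m psi l p).

End LocalFormulas.

Definition dirac_harmonic
    (psi : sp_index S -> mindex N -> 'I_n -> M -> 'cV[R[i]]_2) : Prop :=
  [/\ smooth_map phi, is_twisted_spinor psi &
    forall a d i p, sp_dom a p -> cdom (matlas d) (phi p) ->
      (tension phi (sp_chart a) d i p)%:C = curvature_term a d (psi a d) i p /\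
      dirac_along a d (psi a d) i p = 0].

(* \sum_k eps_k . Psi (x) phi_* eps_k, where eps a p stores, in the chart
   sp_chart a, a basis of the tangent space at p. *)
Definition spinor_along (eps : sp_index S -> M -> 'M[R]_2)
    (Psi : sp_index S -> M -> 'cV[R[i]]_2) :
    sp_index S -> mindex N -> 'I_n -> M -> 'cV[R[i]]_2 :=
  fun a d i p =>
    \sum_k (dvec (matlas (sp_chart a)) (row k (eps a p)) (mapcoord phi d i) p)%:C
      *: (cliff a p (row k (eps a p)) *m Psi a p).

End Spinors.

(* Main.v *)
(* In a local orthonormal frame e the spinor along phi is
   psi^i = \sum_k (e_k phi^i) e_k . Psi.  Since the spin connection is
   compatible with Clifford multiplication,
   D psi^i = \sum_(l, k) e_l . e_k . (H^i_lk Psi + (e_k phi^i) nabla_(e_l) Psi),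
   where H^i = nabla d phi^i is symmetric.  The first part is - tr H^i Psi
   = - tau^i(phi) Psi = 0; in the second, nabla_(e_l) Psi = - 1/2 e_l . D Psi
   and \sum_l e_l . v . e_l = 0 for every vector v in dimension 2.  In Cl_2 also
   u . x . v = v . x . u for all vectors, so <psi^k, grad phi^j . psi^l> is
   symmetric in k and l while R^i_jkl is antisymmetric: the curvature term
   vanishes. *)
From mathcomp Require Import all_boot all_order all_algebra.
From mathcomp Require Import boolp classical_sets functions reals.
From mathcomp Require Import topology normedtype landau derive.
From mathcomp Require Import complex ring.
Require Import Defs.
Import Order.TTheory GRing.Theory Num.Theory.
Import numFieldNormedType.Exports.
Local Open Scope classical_set_scope.
Local Open Scope ring_scope.
Local Open Scope complex_scope.
Set Implicit Arguments.
Unset Strict Implicit.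
Unset Printing Implicit Defensive.

(** * Calculus in coordinate space *)

(** Over a spin trivialization Clifford multiplication by the frame is the constant matrix
    [gamma k], so the spinor along [phi] takes the form [cvec w *m Psi] with w the row of the e_k
    phi^i. Every derivative is taken of this form: the basis [eps] in the definition is only known
    to be orthonormal at each point, not to vary smoothly. Compatibility of the spin connection with
    Clifford multiplication has to be extracted from its potential. The commutator of 1/4 \sum W_kl
    e_k e_l with the vector w is the vector w W as soon as W is antisymmetric, and antisymmetry of
    the connection matrix is metric compatibility of the Christoffel symbols. Symmetry of H^i rests
    on the equality of mixed partial derivatives, here a consequence of the mean value theorem.
    Smoothness means differentiability of all iterated partials, so its closure properties are
    coinductive. Besides the two equations, the local expressions must be shown to glue to a smooth
    section, under changes of trivialization and of target chart. *)

Lemma near_eq_differentiable (R : numFieldType) (V W : normedModType R)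
    (f g : V -> W) (x : V) :
  (\forall y \near x, f y = g y) -> differentiable f x -> differentiable g x.
Proof.
move=> fg df; have fgx : f x = g x by exact: (nbhs_singleton fg).
have [cdf fE] := (diff_locallyP x f).1 df.
have gE : g \o shift x = cst (g x) + 'd f x +o_ 0 id.
  apply/eqaddoP => e e0; rewrite -fgx.
  move/eqaddoP: fE => /(_ e e0) fE.
  have fg0 : \forall y \near 0, f (y + x) = g (y + x).
    by move: fg; rewrite (near_shift 0) /= subr0.
  near=> y; rewrite /= !fctE /= -(near fg0 y) //; near: y; exact: fE.
have dE : 'd g x = 'd f x :> (V -> W) by exact: diff_unique.
by apply/diff_locallyP; rewrite dE.
Unshelve. all: by end_near. Qed.

Section Partial.
Variables (R : realType) (n : nat).
Implicit Types (f g : 'rV[R]_n -> R) (x : 'rV[R]_n) (A : set 'rV[R]_n).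

Lemma partial_near f g x i :
  (\forall y \near x, f y = g y) -> partial i f x = partial i g x.
Proof. exact: near_eq_derive. Qed.

Lemma partialD f g x i : differentiable f x -> differentiable g x ->
  partial i (fun y => f y + g y) x = partial i f x + partial i g x.
Proof.
by move=> df dg; rewrite /partial [LHS]deriveD //; exact: diff_derivable.
Qed.

Lemma partialM f g x i : differentiable f x -> differentiable g x ->
  partial i (fun y => f y * g y) x = partial i f x * g x + f x * partial i g x.
Proof.
move=> df dg; rewrite /partial [LHS]deriveM; [|exact: diff_derivable..].
by rewrite addrC mulrC.
Qed.

Lemma partial_cst x i (k : R) : partial i (fun=> k) x = 0.
Proof. exact: derive_cst. Qed.

Lemma derive_partial f x (v : 'rV[R]_n) : differentiable f x ->
  'D_v f x = \sum_i v 0 i * partial i f x.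
Proof.
move=> df; rewrite deriveE // {1}(row_sum_delta v) linear_sum /=.
by apply: eq_bigr => i _; rewrite linearZ /= /partial deriveE.
Qed.

Lemma smooth_on_subset A B f : A `<=` B -> smooth_on B f -> smooth_on A f.
Proof. by move=> AB sf s x /AB; exact: sf. Qed.

Lemma smooth_on_differentiable A f x :
  smooth_on A f -> A x -> differentiable f x.
Proof. by move=> sf Ax; exact: (sf [::] x Ax). Qed.

Lemma smooth_on_partial A f i : smooth_on A f -> smooth_on A (partial i f).
Proof. by move=> sf s x Ax; have := sf (rcons s i) x Ax; rewrite foldr_rcons. Qed.

Lemma open_eq_near A f g x : open A -> A x -> {in A, f =1 g} ->
  \forall y \near x, f y = g y.
Proof.
move=> oA Ax fg; have : \forall y \near x, A y by exact: open_nbhs_nbhs.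
by apply: filterS => y Ay; apply: fg; rewrite inE.
Qed.

Lemma smooth_on_eq A f g : open A -> {in A, f =1 g} ->
  smooth_on A f -> smooth_on A g.
Proof.
move=> oA fg sf s x Ax; apply: near_eq_differentiable (sf s x Ax).
apply: (open_eq_near oA Ax); elim: s {x Ax} => [//|i s IH] x; rewrite inE => Ax.
by apply: partial_near; exact: (open_eq_near oA Ax).
Qed.

(** The list of partials is consumed from its last entry, the derivative taken first, so that the
    result can be replaced by another member of P before the remaining derivatives act; openness of
    A makes these respect equality on A. *)
Lemma smooth_on_coind A (P : ('rV[R]_n -> R) -> Prop) : open A ->
  (forall f, P f -> forall x, A x -> differentiable f x) ->
  (forall f, P f -> forall i, exists2 g, P g & {in A, partial i f =1 g}) ->
  forall f, P f -> smooth_on A f.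
Proof.
move=> oA Pdiff Ppart f Pf s; elim/last_ind: s f Pf => [|s i IH] f Pf x Ax.
  exact: Pdiff.
rewrite foldr_rcons; have [g Pg fg] := Ppart f Pf i.
apply: near_eq_differentiable (IH g Pg x Ax); apply: (open_eq_near oA Ax).
elim: s {x Ax IH} => [|j s IH] x; rewrite inE => Ax /=.
  by rewrite fg // inE.
by apply: partial_near; exact: (open_eq_near oA Ax).
Qed.

(* Unlike the products themselves, their sums are stable under partial
   differentiation, as smooth_on_coind requires. *)
Inductive sum_of_products A : ('rV[R]_n -> R) -> Prop :=
| SumProd_mul f g : smooth_on A f -> smooth_on A g ->
    sum_of_products A (fun x => f x * g x)
| SumProd_add f g : sum_of_products A f -> sum_of_products A g ->
    sum_of_products A (fun x => f x + g x).

Lemma sum_of_products_differentiable A f : sum_of_products A f ->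
  forall x, A x -> differentiable f x.
Proof.
elim=> {f} [f g sf sg|f g _ IHf _ IHg] x Ax.
  by apply: differentiableM; exact: smooth_on_differentiable Ax.
by apply: differentiableD; [exact: IHf|exact: IHg].
Qed.

Lemma smooth_on_sum_of_products A f : open A ->
  sum_of_products A f -> smooth_on A f.
Proof.
move=> oA; apply: smooth_on_coind => // {}f.
  exact: sum_of_products_differentiable.
elim=> {f} [f g sf sg|f g Sf IHf Sg IHg] i.
  exists (fun x => partial i f x * g x + f x * partial i g x).
    by apply: SumProd_add; apply: SumProd_mul => //; exact: smooth_on_partial.
  by move=> x; rewrite inE => Ax; apply: partialM;
    exact: smooth_on_differentiable Ax.
have [f' Sf' ff'] := IHf i; have [g' Sg' gg'] := IHg i.
exists (fun x => f' x + g' x); first exact: SumProd_add.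
move=> x xA; rewrite partialD ?ff' ?gg' //; move: xA; rewrite inE => Ax.
  exact: sum_of_products_differentiable Ax.
exact: sum_of_products_differentiable Ax.
Qed.

Lemma smooth_on_cst A (k : R) : open A -> smooth_on A (fun=> k).
Proof.
move=> oA; apply: (@smooth_on_coind _ (fun f => exists c, f = fun=> c)) => //.
- by move=> _ [c ->] x _; exact: differentiable_cst.
- move=> _ [c ->] i; exists (fun=> 0); first by exists 0.
  by move=> x _; exact: partial_cst.
by exists k.
Qed.

Lemma smooth_onM A f g : open A -> smooth_on A f -> smooth_on A g ->
  smooth_on A (fun x => f x * g x).
Proof. by move=> oA sf sg; exact/smooth_on_sum_of_products/SumProd_mul. Qed.

Lemma smooth_onD A f g : open A -> smooth_on A f -> smooth_on A g ->
  smooth_on A (fun x => f x + g x).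
Proof.
move=> oA sf sg; have s1 := smooth_on_cst 1 oA.
(* The class is generated by products, so each summand enters it multiplied by 1. *)
have: sum_of_products A (fun x => f x * 1 + g x * 1).
  by apply: SumProd_add; exact: SumProd_mul.
by move/(smooth_on_sum_of_products oA); apply: smooth_on_eq => // x _;
  rewrite !mulr1.
Qed.

Lemma smooth_on_sum A (I : Type) (r : seq I) (F : I -> 'rV[R]_n -> R) :
  open A -> (forall i, smooth_on A (F i)) ->
  smooth_on A (fun x => \sum_(i <- r) F i x).
Proof.
move=> oA sF; elim: r => [|i r IH].
  by apply: smooth_on_eq (smooth_on_cst 0 oA) => // x _; rewrite big_nil.
by apply: smooth_on_eq (smooth_onD oA (sF i) IH) => // x _; rewrite big_cons.
Qed.

End Partial.

(** * Symmetry of mixed partial derivatives *)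

Section Schwarz.
Variable R : realType.

(** [MVT] for the real function t |-> f (y + t *: v), whose difference quotient at s is that of f at
    y + s *: v in the direction v. *)
Lemma mean_value_line (V : normedModType R) (f : V -> R) (y v : V) (h : R) :
  0 < h -> (forall s, 0 <= s <= h -> derivable f (y + s *: v) v) ->
  exists2 s, 0 <= s <= h & f (y + h *: v) - f y = h * 'D_v f (y + s *: v).
Proof.
move=> h0 df; pose F (t : R) := f (y + t *: v).
have dF s : 0 <= s <= h -> is_derive s 1 F ('D_v f (y + s *: v)).
  move=> sh; have E : (fun t : R => t^-1 *: (F (t *: 1 + s) - F s)) =
                      (fun t => t^-1 *: (f (t *: v + (y + s *: v)) - f (y + s *: v))).
    by apply/funext => t; rewrite /F scalerDl [_ *: 1]mulr1 addrCA.
  by split; rewrite ?/derivable ?/derive E //; exact: df.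
have [|z|s sh E] := @MVT R F (fun s => 'D_v f (y + s *: v)) 0 h h0.
- by move=> z /itvP zh; apply: dF; rewrite !zh.
- apply: derivable_within_continuous => s /itvP sh.
  by have [] := dF s; rewrite ?sh.
exists s; first by rewrite !(itvP sh).
by move: E; rewrite /F scale0r addr0 subr0 mulrC.
Qed.

(** The second difference is the increment along u of y |-> f (y + h *: v) - f y. The mean value
    theorem along u makes it h times an increment of D_u f along v, and a second use along v
    finishes. The bound on h keeps the whole parallelogram inside the ball. *)
Lemma second_difference (V : normedModType R) (f : V -> R) (x u v : V)
    (h e : R) :
  (forall y, ball x e y -> derivable f y u) ->
  (forall y, ball x e y -> derivable ('D_u f) y v) ->
  0 < h -> h * (`|u| + `|v|) < e ->
  exists2 y, ball x e y &
    f (x + h *: u + h *: v) - f (x + h *: u) - f (x + h *: v) + f x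
      = h * (h * 'D_v ('D_u f) y).
Proof.
move=> dfu dfuv h0 he.
have near s t : 0 <= s <= h -> 0 <= t <= h -> ball x e (x + s *: u + t *: v).
  move=> /andP[s0 sh] /andP[t0 th]; rewrite -ball_normE /ball_ /=.
  rewrite -addrA opprD addrA subrr sub0r normrN.
  apply: le_lt_trans he; apply: le_trans (ler_normD _ _) _.
  rewrite !normrZ !ger0_norm // mulrDr.
  by apply: lerD; apply: ler_wpM2r.
have hh : 0 <= h <= h by rewrite lexx ltW.
have h00 : 0 <= (0 : R) <= h by rewrite lexx ltW.
pose g y := f (y + h *: v) - f y.
have dg s : 0 <= s <= h -> is_derive (x + s *: u) u g
    ('D_u f (x + s *: u + h *: v) - 'D_u f (x + s *: u)).
  move=> sh; apply: is_deriveB; last first.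
    by apply: derivableP; apply: dfu; have := near s 0 sh h00; rewrite scale0r addr0.
  have dd := dfu _ (near s h sh hh).
  have E : (fun t : R => t^-1 *: (f (t *: u + (x + s *: u) + h *: v)
                                  - f (x + s *: u + h *: v))) =
       (fun t => t^-1 *: (f (t *: u + (x + s *: u + h *: v)) - f (x + s *: u + h *: v))).
    by apply/funext => t; rewrite !addrA.
  by split; rewrite ?/derivable ?/derive E //; exact: df.
have [s sh E1] := mean_value_line h0 (fun s sh => @ex_derive _ _ _ _ _ _ _ (dg s sh)).
have E2 := @derive_val _ _ _ _ _ _ _ (dg s sh).
have [t th E3] := mean_value_line h0 (fun t th => dfuv _ (near s t sh th)).
exists (x + s *: u + t *: v); first exact: near.
by rewrite -E3 -E2 -E1 /g; ring.
Qed.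

(** The points y and z may differ: the mean value theorem gives a separate intermediate point for
    each order of differentiation. *)
Lemma continuous_eq_near (V : normedModType R) (F G : V -> R) (x : V) :
  {for x, continuous F} -> {for x, continuous G} ->
  (forall r, 0 < r -> exists2 y, ball x r y & exists2 z, ball x r z & F y = G z) ->
  F x = G x.
Proof.
move=> cF cG FG; apply/eqP; rewrite -subr_eq0 -normr_le0.
apply/ler_addgt0Pr => e e0; have e20 : 0 < e / 2 by rewrite divr_gt0.
have /nbhs_ballP[r1 /= r10 rF] : nbhs x (fun y => `|F x - F y| < e / 2).
  by move/cvgrPdist_lt : cF; apply.
have /nbhs_ballP[r2 /= r20 rG] : nbhs x (fun y => `|G x - G y| < e / 2).
  by move/cvgrPdist_lt : cG; apply.
have [|y yr [z zr Fyz]] := FG (Num.min r1 r2); first by rewrite lt_min r10.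
have Fy : `|F x - F y| < e / 2.
  by apply: rF; apply: le_ball yr; rewrite ge_min lexx.
have Gz : `|G x - G z| < e / 2.
  by apply: rG; apply: le_ball zr; rewrite ge_min lexx orbT.
rewrite add0r (_ : F x - G x = (F x - F y) - (G x - G z)); last first.
  by rewrite Fyz; ring.
by rewrite (le_trans (ler_normB _ _)) // (splitr e); apply/ltW; exact: ltrD.
Qed.

(** The second difference is symmetric in u and v, so the two mixed partials take a common value at
    two points arbitrarily close to x; their continuity carries the equality to x. *)
Lemma partialC n (A : set 'rV[R]_n) (f : 'rV[R]_n -> R) x i j :
  open A -> smooth_on A f -> A x ->
  partial i (partial j f) x = partial j (partial i f) x.
Proof.
move=> oA sf Ax.
have cpp k l : {for x, continuous (partial k (partial l f))}.
  apply/differentiable_continuous/(smooth_on_differentiable _ Ax).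
  by do 2 apply: smooth_on_partial.
apply: continuous_eq_near => // r0 r00.
have /nbhs_ballP[r1 /= r10 r1A] : nbhs x A by exact: open_nbhs_nbhs.
pose r := Num.min r0 r1; have rr0 : 0 < r by rewrite lt_min r00.
have rA y : ball x r y -> A y.
  by move=> yr; apply: r1A; apply: le_ball yr; rewrite ge_min lexx orbT.
have rB y : ball x r y -> ball x r0 y.
  by apply: le_ball; rewrite ge_min lexx.
pose u : 'rV[R]_n := delta_mx 0 i; pose v : 'rV[R]_n := delta_mx 0 j.
have K0 : 0 < `|u| + `|v| + 1 by rewrite ltr_wpDl // addr_ge0.
(* The summand 1 makes the denominator visibly positive and the bound [hr] strict. *)
pose h := r / (`|u| + `|v| + 1).
have h0 : 0 < h by rewrite divr_gt0.
have hr : h * (`|u| + `|v|) < r.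
  by rewrite /h mulrAC ltr_pdivrMr // ltr_pM2l // ltrDl.
have dp k y : ball x r y -> derivable f y (delta_mx 0 k).
  by move=> /rA Ay; apply/diff_derivable/(smooth_on_differentiable sf Ay).
have dpp k l y : ball x r y -> derivable (partial k f) y (delta_mx 0 l).
  move=> /rA Ay; apply/diff_derivable.
  exact: (smooth_on_differentiable (smooth_on_partial k sf) Ay).
have [y yr Ey] := second_difference (dp i) (dpp i j) h0 hr.
have hr' : h * (`|v| + `|u|) < r by rewrite addrC.
have [z zr Ez] := second_difference (dp j) (dpp j i) h0 hr'.
exists z; first exact: rB.
exists y; first exact: rB.
apply: (mulfI (lt0r_neq0 h0)); apply: (mulfI (lt0r_neq0 h0)).
rewrite -[LHS]Ez -[RHS]Ey (addrAC x) -/u -/v; ring.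
Qed.

End Schwarz.

(** * The chain rule *)

Section PartialComp.
Variables (R : realType) (m n : nat).

Lemma differentiable_row (V : normedModType R) (g : 'I_m -> V -> R) x :
  (forall j, differentiable (g j) x) ->
  differentiable (fun y => \row_j g j y) x.
Proof.
move=> dg; rewrite (_ : (fun _ => _) = \sum_j (fun y => g j y *: delta_mx 0 j)).
  by apply: differentiable_sum => j; exact: differentiableZl.
apply/funext => y; rewrite fct_sumE [LHS]row_sum_delta.
by apply: eq_bigr => j _; rewrite mxE.
Qed.

Lemma partial_comp (g : 'I_m -> 'rV[R]_n -> R) (f : 'rV[R]_m -> R) x i :
  (forall j, differentiable (g j) x) ->
  differentiable f (\row_j g j x) ->
  partial i (fun y => f (\row_j g j y)) x =
  \sum_j partial i (g j) x * partial j f (\row_j g j x).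
Proof.
move=> dg df; have dG := differentiable_row dg.
rewrite /partial deriveE; last exact: (differentiable_comp dG df).
rewrite (diff_comp dG df) /= -deriveE // derive_partial //.
apply: eq_bigr => j _; congr (_ * _).
rewrite -deriveE // derive_mx; last exact: diff_derivable.
by rewrite mxE; congr ('D__ _ _); apply/funext => y; rewrite mxE.
Qed.

End PartialComp.

(** * Calculus in a chart *)

Section ChartTheory.
Variables (R : realType) (n : nat) (T : topologicalType) (c : chart R n T).
Implicit Types (U : set T) (f g : T -> R) (p : T) (X : 'rV[R]_n).

Definition chart_diff f p := differentiable (f \o cinv c) (c p).

Lemma cinv_near p (P : T -> Prop) : cdom c p ->
  (\forall q \near p, P q) -> \forall x \near c p, P (cinv c x).
Proof.
move=> cp Pp; apply: (cinv_cont (c := c)) => /=; first by exists p.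
by rewrite cmapK.
Qed.

(** Near a point of the image, c @[U contains the intersection of c @] cdom c with the preimage of U
    under [cinv c], which is continuous there. *)
Lemma open_chart_image U : open U -> U `<=` cdom c -> open (c @` U).
Proof.
move=> oU Uc; rewrite openE => _ [p Up <-]; have cp := Uc _ Up.
have nU : \forall q \near p, U q by exact: open_nbhs_nbhs.
have nI : \forall x \near c p, (c @` cdom c) x.
  by apply: (@open_nbhs_nbhs _ (c p) (c @` cdom c)); split; [exact: cimg_open|exists p].
apply: (@filterS2 _ _ _ _ _ (c @` U) _ (cinv_near cp nU) nI) => x Ux [q cq qx].
by exists q => //; move: Ux; rewrite -qx cmapK.
Qed.

Lemma in_chart_image U x : x \in c @` U -> exists2 p, U p & c p = x.
Proof. by rewrite inE. Qed.

Lemma pd_near f g p i : cdom c p -> (\forall q \near p, f q = g q) ->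
  pd c i f p = pd c i g p.
Proof. by move=> cp fg; apply: partial_near; exact: (cinv_near cp fg). Qed.

Lemma pdD f g p i : chart_diff f p -> chart_diff g p ->
  pd c i (fun q => f q + g q) p = pd c i f p + pd c i g p.
Proof. exact: partialD. Qed.

Lemma pdM f g p i : cdom c p -> chart_diff f p -> chart_diff g p ->
  pd c i (fun q => f q * g q) p = pd c i f p * g p + f p * pd c i g p.
Proof. by move=> cp df dg; rewrite /pd [LHS]partialM //= cmapK. Qed.

Lemma pd_cst p i (k : R) : pd c i (fun=> k) p = 0.
Proof. exact: partial_cst. Qed.

Lemma chart_diff_near f g p : cdom c p -> (\forall q \near p, f q = g q) ->
  chart_diff f p -> chart_diff g p.
Proof. by move=> cp fg; apply: near_eq_differentiable; exact: (cinv_near cp fg). Qed.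

Lemma chart_diff_cst (k : R) p : chart_diff (fun=> k) p.
Proof. exact: differentiable_cst. Qed.

Lemma chart_diffD f g p : chart_diff f p -> chart_diff g p ->
  chart_diff (fun q => f q + g q) p.
Proof. exact: differentiableD. Qed.

Lemma chart_diffM f g p : chart_diff f p -> chart_diff g p ->
  chart_diff (fun q => f q * g q) p.
Proof. exact: differentiableM. Qed.

Lemma chart_diff_sum (I : Type) (r : seq I) (F : I -> T -> R) p :
  (forall i, chart_diff (F i) p) -> chart_diff (fun q => \sum_(i <- r) F i q) p.
Proof.
move=> dF; elim: r => [|i r IH].
  by rewrite (_ : (fun _ => _) = fun=> 0);
    [exact: chart_diff_cst|apply/funext => q; rewrite big_nil].
rewrite (_ : (fun _ => _) = fun q => F i q + \sum_(j <- r) F j q).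
  exact: chart_diffD.
by apply/funext => q; rewrite big_cons.
Qed.

Lemma pd_sum (I : Type) (r : seq I) (F : I -> T -> R) p i :
  (forall j, chart_diff (F j) p) ->
  pd c i (fun q => \sum_(j <- r) F j q) p = \sum_(j <- r) pd c i (F j) p.
Proof.
move=> dF; elim: r => [|j r IH].
  rewrite big_nil (_ : (fun _ => _) = fun=> 0) ?pd_cst //.
  by apply/funext => q; rewrite big_nil.
rewrite big_cons -IH -pdD //; last exact: chart_diff_sum.
by congr (pd c i _ p); apply/funext => q; rewrite big_cons.
Qed.

Lemma dvec_near X f g p : cdom c p -> (\forall q \near p, f q = g q) ->
  dvec c X f p = dvec c X g p.
Proof. by move=> cp fg; apply: eq_bigr => i _; rewrite (pd_near i cp fg). Qed.

Lemma dvecD X f g p : chart_diff f p -> chart_diff g p ->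
  dvec c X (fun q => f q + g q) p = dvec c X f p + dvec c X g p.
Proof.
move=> df dg; rewrite /dvec -big_split /=; apply: eq_bigr => i _.
by rewrite pdD // mulrDr.
Qed.

Lemma dvecM X f g p : cdom c p -> chart_diff f p -> chart_diff g p ->
  dvec c X (fun q => f q * g q) p = dvec c X f p * g p + f p * dvec c X g p.
Proof.
move=> cp df dg; rewrite /dvec mulr_suml mulr_sumr -big_split /=.
by apply: eq_bigr => i _; rewrite pdM // mulrDr mulrA mulrCA.
Qed.

Lemma dvec_cst X p (k : R) : dvec c X (fun=> k) p = 0.
Proof. by rewrite /dvec big1 // => i _; rewrite pd_cst mulr0. Qed.

Lemma dvec_sum X (I : Type) (r : seq I) (F : I -> T -> R) p :
  (forall j, chart_diff (F j) p) ->
  dvec c X (fun q => \sum_(j <- r) F j q) p = \sum_(j <- r) dvec c X (F j) p.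
Proof.
move=> dF; rewrite /dvec exchange_big /=; apply: eq_bigr => i _.
by rewrite pd_sum // mulr_sumr.
Qed.

Section SmoothIn.
Variable U : set T.
Hypotheses (oU : open U) (Uc : U `<=` cdom c).
Let oV := open_chart_image oU Uc.

Lemma smooth_in_diff f p : smooth_in c U f -> U p -> chart_diff f p.
Proof. by move=> sf Up; apply: smooth_on_differentiable sf _; exists p. Qed.

Lemma smooth_in_eq f g : (forall p, U p -> f p = g p) ->
  smooth_in c U f -> smooth_in c U g.
Proof.
move=> fg; apply: smooth_on_eq => // x /in_chart_image[p Up <-] /=.
by rewrite cmapK; [exact: fg|exact: Uc].
Qed.

Lemma smooth_in_cst (k : R) : smooth_in c U (fun=> k).
Proof. exact: smooth_on_cst. Qed.

Lemma smooth_inD f g : smooth_in c U f -> smooth_in c U g ->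
  smooth_in c U (fun p => f p + g p).
Proof. exact: smooth_onD. Qed.

Lemma smooth_inM f g : smooth_in c U f -> smooth_in c U g ->
  smooth_in c U (fun p => f p * g p).
Proof. exact: smooth_onM. Qed.

Lemma smooth_in_sum (I : Type) (r : seq I) (F : I -> T -> R) :
  (forall i, smooth_in c U (F i)) -> smooth_in c U (fun p => \sum_(i <- r) F i p).
Proof. exact: smooth_on_sum. Qed.

Lemma smooth_in_pd f i : smooth_in c U f -> smooth_in c U (pd c i f).
Proof.
move=> sf; apply: smooth_on_eq oV _ (smooth_on_partial i sf).
by move=> x /in_chart_image[p Up <-]; rewrite /pd /= cmapK //; exact: Uc.
Qed.

(** Each [pd] goes through [cinv c] and back through c, which cancel only on the image of the
    domain. On the open image of U an iterated [pd] is thus an iterated [partial], to which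
    [partialC] applies. *)
Lemma pdC f p i j : smooth_in c U f -> U p ->
  pd c i (pd c j f) p = pd c j (pd c i f) p.
Proof.
move=> sf Up; have Vp : (c @` U) (c p) by exists p.
have E k l : pd c k (pd c l f) p = partial k (partial l (f \o cinv c)) (c p).
  apply: partial_near; apply: (open_eq_near oV Vp).
  by move=> x /in_chart_image[q Uq <-]; rewrite /pd /= cmapK //; exact: Uc.
by rewrite !E; exact: partialC oV sf Vp.
Qed.

End SmoothIn.

Lemma smooth_in_subset U V f : U `<=` V -> smooth_in c V f -> smooth_in c U f.
Proof. by move=> UV; apply: smooth_on_subset; exact: image_subset. Qed.

(** Near p the map F stays in the domain of c', so the composite is the local expression of h
    evaluated at the row of coordinates of F. With F the identity this governs changes of chart on
    M, with F = [phi] changes of chart on the target. *)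
Lemma pd_comp m (T' : topologicalType) (c' : chart R m T') (F : T -> T')
    (h : T' -> R) p i :
  cdom c p -> (\forall q \near p, cdom c' (F q)) ->
  (forall j, chart_diff (fun q => chart_coord c' j (F q)) p) ->
  differentiable (h \o cinv c') (c' (F p)) ->
  pd c i (h \o F) p =
  \sum_j pd c i (fun q => chart_coord c' j (F q)) p * pd c' j h (F p).
Proof.
move=> cp cF dF dh.
pose g j := (fun q => chart_coord c' j (F q)) \o cinv c.
have gE x : \row_j g j x = c' (F (cinv c x)).
  by apply/rowP => j; rewrite mxE.
have gp : \row_j g j (c p) = c' (F p) by rewrite gE cmapK.
rewrite [LHS](_ : _ = partial i (fun y => (h \o cinv c') (\row_j g j y)) (c p)).
  by rewrite partial_comp ?gp.
apply: partial_near; apply: filterS (cinv_near cp cF) => x c'x.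
by rewrite gE /= cmapK.
Qed.

End ChartTheory.

(** * The Clifford algebra Cl_2 *)

Lemma ord2P (P : 'I_2 -> Type) : P 0 -> P 1 -> forall k, P k.
Proof.
move=> P0 P1 [[|[|//]] k2].
  by rewrite (_ : Ordinal k2 = 0) //; exact/val_inj.
by rewrite (_ : Ordinal k2 = 1) //; exact/val_inj.
Qed.

Lemma sum_ord2 (V : nmodType) (F : 'I_2 -> V) : \sum_k F k = F 0 + F 1.
Proof.
by rewrite !big_ord_recl big_ord0 addr0; congr (_ + F _); exact/val_inj.
Qed.

Section Clifford2.
Variable R : realType.
Implicit Types (u v w : 'rV[R]_2) (x y : 'cV[R[i]]_2) (H : 'M[R]_2).

(** Clifford multiplication by the vector with components w in the trivializing frame; the matrices
    being constant, only w varies with the point. *)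
Definition cvec w : 'M[R[i]]_2 := \sum_k (w 0 k)%:C *: gamma k.

Lemma cliffordE (G E : 'M[R]_2) u : clifford G E u = cvec (u *m G *m E^T).
Proof.
apply: eq_bigr => k _; congr (_%:C *: _).
by rewrite !mxE; apply: eq_bigr => j _; rewrite !mxE.
Qed.

Lemma cvec_linear (a : R) u v :
  cvec (a *: u + v) = a%:C *: cvec u + cvec v.
Proof.
rewrite /cvec scaler_sumr -big_split /=; apply: eq_bigr => k _.
by rewrite !mxE rmorphD rmorphM scalerDl scalerA.
Qed.

Lemma cvecD u v : cvec (u + v) = cvec u + cvec v.
Proof. by rewrite -[u in LHS]scale1r cvec_linear scale1r. Qed.

Lemma cvec0 : cvec 0 = 0.
Proof. by rewrite /cvec big1 // => k _; rewrite mxE scale0r. Qed.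

Lemma cvecZ (a : R) u : cvec (a *: u) = a%:C *: cvec u.
Proof. by rewrite -[_ *: u]addr0 cvec_linear cvec0 addr0. Qed.

Lemma cvec_sum (I : Type) (r : seq I) (F : I -> 'rV[R]_2) :
  cvec (\sum_(i <- r) F i) = \sum_(i <- r) cvec (F i).
Proof.
elim: r => [|i r IH]; first by rewrite !big_nil cvec0.
by rewrite !big_cons cvecD IH.
Qed.

Lemma cvec_delta k : cvec (delta_mx 0 k) = gamma k.
Proof.
rewrite /cvec (bigD1 k) //= big1 ?addr0 ?mxE ?eqxx ?scale1r //.
by move=> l lk; rewrite mxE eqxx (negPf lk) scale0r.
Qed.

Lemma cvecE w : cvec w = \matrix_(r, s) (if r == s then 0 else
  if r == 0 then w 0 0 +i* w 0 1 else (- w 0 0) +i* w 0 1).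
Proof.
apply/matrixP => r s; rewrite summxE sum_ord2 !mxE.
by case: r s => [[|[|//]] ?] [[|[|//]] ?]; apply/eqP;
  rewrite eq_complex /=; apply/andP; split; apply/eqP; rewrite /=; ring.
Qed.

Lemma cvec_mul w x : cvec w *m x = \col_s
  (if s == 0 then (w 0 0 +i* w 0 1) * x 1 0 else ((- w 0 0) +i* w 0 1) * x 0 0).
Proof.
apply/colP => s; rewrite cvecE !mxE sum_ord2 !mxE.
by case: s => [[|[|//]] ?] /=; rewrite mul0r ?addr0 ?add0r.
Qed.

Lemma hdot_cvec w x y : hdot (cvec w *m x) y = - hdot x (cvec w *m y).
Proof.
rewrite /hdot !cvec_mul !sum_ord2 !mxE /=.
move: (x _ 0) (x _ 0) (y _ 0) (y _ 0) => [a b] [c d] [e f] [g h].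
by apply/eqP; rewrite eq_complex /=; apply/andP; split; apply/eqP; ring.
Qed.

(* Reversal fixes odd elements of the even-dimensional algebra Cl_2, since
   these are all vectors. *)
Lemma cvec_reverse u v w : cvec u *m cvec v *m cvec w = cvec w *m cvec v *m cvec u.
Proof.
apply/matrixP => r s; rewrite !cvecE !mxE !sum_ord2 !mxE !sum_ord2 !mxE.
by case: r s => [[|[|//]] ?] [[|[|//]] ?] /=; ring.
Qed.

(** Moving the outer factor across the Hermitian product costs the same sign on both sides, and what
    remains is [cvec_reverse]. *)
Lemma hdot_cvec_sym u v w x :
  hdot (cvec u *m x) (cvec v *m (cvec w *m x)) =
  hdot (cvec w *m x) (cvec v *m (cvec u *m x)).
Proof.
rewrite (hdot_cvec u x) (hdot_cvec w x); congr (- hdot x _).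
by rewrite !mulmxA cvec_reverse.
Qed.

(** The product e_k w e_k is - w for w parallel to e_k and w for w orthogonal to it, so in dimension
    n the sum is (n - 2) w. *)
Lemma gamma_sandwich w : \sum_k gamma k *m cvec w *m gamma k = 0 :> 'M[R[i]]_2.
Proof.
apply/matrixP => r s; rewrite sum_ord2 -!cvec_delta !cvecE.
rewrite !mxE !sum_ord2 !mxE !sum_ord2 !mxE.
by case: r s => [[|[|//]] ?] [[|[|//]] ?]; apply/eqP;
  rewrite eq_complex /=; apply/andP; split; apply/eqP; rewrite /=; ring.
Qed.

(** By symmetry of H the products e_k e_l with k <> l cancel in pairs, and each e_k e_k is - 1. *)
Lemma gamma_trace H : H^T = H ->
  \sum_k gamma k *m cvec (row k H) = (- (\tr H)%:C)%:M.
Proof.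
move=> Hs; have H10 : H 1 0 = H 0 1 by rewrite -{1}Hs mxE.
apply/matrixP => r s; rewrite sum_ord2 -!cvec_delta !cvecE.
rewrite /mxtrace !mxE !sum_ord2 !mxE /= H10.
by case: r s => [[|[|//]] ?] [[|[|//]] ?]; apply/eqP;
  rewrite eq_complex /=; apply/andP; split; apply/eqP; rewrite /=; ring.
Qed.

(** The quarter turn e_0 -> e_1 -> - e_0, induced on vectors by left multiplication with the volume
    element e_0 e_1; right multiplication induces its opposite. *)
Definition rot2 w : 'rV[R]_2 := \row_k (if k == 0 then - w 0 1 else w 0 0).

Lemma gamma01_cvec w : gamma 0 *m gamma 1 *m cvec w = cvec (rot2 w).
Proof.
apply/matrixP => r s; rewrite -!cvec_delta !cvecE.
rewrite !mxE !sum_ord2 !mxE !sum_ord2 !mxE.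
by case: r s => [[|[|//]] ?] [[|[|//]] ?]; apply/eqP;
  rewrite eq_complex /=; apply/andP; split; apply/eqP; rewrite /=; ring.
Qed.

Lemma cvec_gamma01 w : cvec w *m (gamma 0 *m gamma 1) = - cvec (rot2 w).
Proof.
apply/matrixP => r s; rewrite -!cvec_delta !cvecE.
rewrite !mxE !sum_ord2 !mxE !sum_ord2 !mxE.
by case: r s => [[|[|//]] ?] [[|[|//]] ?]; apply/eqP;
  rewrite eq_complex /=; apply/andP; split; apply/eqP; rewrite /=; ring.
Qed.

(** The element of the Lie algebra of Spin(2) over an antisymmetric W; for W the connection matrix
    it is the potential in [nabla_spin]. *)
Definition spin_potential (W : 'M[R]_2) : 'M[R[i]]_2 :=
  4^-1 *: \sum_k \sum_l (W k l)%:C *: (gamma k *m gamma l).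

(** The differential of the covering of SO(2) by Spin(2). Antisymmetry leaves only W 0 1, counted
    twice, so 1/4 becomes 1/2; the commutator of e_0 e_1 with w is twice [rot2 w], which absorbs
    this 1/2. *)
Lemma spin_potential_cvec (W : 'M[R]_2) w : W^T = - W ->
  spin_potential W *m cvec w = cvec w *m spin_potential W + cvec (w *m W).
Proof.
move=> Wa; have WE i j : W j i = - W i j by have /matrixP/(_ i j) := Wa; rewrite !mxE.
have W0 i : W i i = 0.
  by have /eqP := WE i i; rewrite -addr_eq0 -mulr2n mulrn_eq0 => /eqP.
have pE : spin_potential W = (2^-1 * (W 0 1)%:C) *: (gamma 0 *m gamma 1).
  rewrite /spin_potential !sum_ord2 !W0 [W 1 0]WE.
  have -> : gamma 1 *m gamma 0 = - (gamma 0 *m gamma 1) :> 'M[R[i]]_2.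
    by apply/eqP; rewrite -addr_eq0 gamma_clifford mulr0 oppr0 raddf0.
  rewrite !scale0r !add0r !addr0 rmorphN scalerN scaleNr opprK.
  by rewrite -scalerDl scalerA; congr (_ *: _); field.
have -> : w *m W = W 0 1 *: rot2 w.
  apply/rowP => k; rewrite !mxE sum_ord2.
  elim/ord2P: k; rewrite W0 ?W0 /= ?[W 1 0]WE; ring.
rewrite pE cvecZ -scalemxAl -scalemxAr gamma01_cvec cvec_gamma01.
rewrite scalerN -[in RHS]scaleNr -scalerDl; congr (_ *: _); by field.
Qed.

End Clifford2.

(** * The Levi-Civita connection *)

Section Riemannian.
Variables (R : realType) (n : nat) (M : riemannian_manifold R n).
Variable c : mindex M.
Implicit Types (p : M) (X : 'rV[R]_n) (Y Z : M -> 'rV[R]_n).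

Lemma cdom_near p : cdom (matlas c) p -> \forall q \near p, cdom (matlas c) q.
Proof. by move=> cp; apply: open_nbhs_nbhs; split => //; exact: cdom_open. Qed.

Lemma metric_diff p i j : cdom (matlas c) p ->
  chart_diff (matlas c) (fun q => metric c q i j) p.
Proof. by apply: smooth_in_diff; exact: metric_smooth. Qed.

Lemma pd_metric_sym p i j k : cdom (matlas c) p ->
  pd (matlas c) k (fun q => metric c q i j) p
  = pd (matlas c) k (fun q => metric c q j i) p.
Proof.
move=> cp; apply: pd_near => //; apply: filterS (cdom_near cp) => q cq.
by rewrite -[in LHS](metric_sym cq) mxE.
Qed.

Lemma christoffel_sym p k i j : cdom (matlas c) p ->
  christoffel c k i j p = christoffel c k j i p.
Proof.
move=> cp; congr (_ * _); apply: eq_bigr => l _.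
by rewrite (pd_metric_sym i j) // [in LHS]addrC [in LHS](addrC (pd _ i _ _)) [in LHS]addrC.
Qed.

(** Contraction with the metric cancels the inverse metric in [christoffel] and leaves half the
    Koszul combination of derivatives. *)
Lemma christoffel_lower p a b j : cdom (matlas c) p ->
  metric c p \in unitmx ->
  \sum_i christoffel c i a b p * metric c p i j =
  2^-1 * (pd (matlas c) a (fun q => metric c q b j) p
    + pd (matlas c) b (fun q => metric c q a j) p
    - pd (matlas c) j (fun q => metric c q a b) p).
Proof.
move=> cp Gu; pose F l := pd (matlas c) a (fun q => metric c q b l) p
    + pd (matlas c) b (fun q => metric c q a l) p
    - pd (matlas c) l (fun q => metric c q a b) p.
have -> : 2^-1 * F j = 2^-1 * \sum_l ((metric c p *m invmx (metric c p)) j l * F l).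
  rewrite mulmxV // (bigD1 j) //= mxE eqxx mul1r big1 ?addr0 // => l lj.
  by rewrite mxE eq_sym (negPf lj) mul0r.
transitivity (\sum_i \sum_l 2^-1 * (metric c p j i * invmx (metric c p) i l * F l)).
  apply: eq_bigr => i _; rewrite /christoffel -mulrA mulr_suml mulr_sumr.
  by apply: eq_bigr => l _; rewrite -{2}(metric_sym cp) mxE -/(F l); ring.
rewrite exchange_big mulr_sumr; apply: eq_bigr => l _ /=.
by rewrite mxE mulr_suml mulr_sumr.
Qed.

Lemma innerE X (Z : 'rV[R]_n) p : inner c X Z p = \sum_i \sum_j X 0 i * metric c p i j * Z 0 j.
Proof.
rewrite /inner mxE exchange_big /=; apply: eq_bigr => j _.
by rewrite !mxE mulr_suml.
Qed.

Lemma inner_sym X (Z : 'rV[R]_n) p : cdom (matlas c) p -> inner c X Z p = inner c Z X p.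
Proof.
move=> cp; rewrite !innerE exchange_big /=.
apply: eq_bigr => j _; apply: eq_bigr => i _.
by rewrite -{1}(metric_sym cp) mxE; ring.
Qed.

(** The part of [nabla_vec] of order zero in the differentiated field. *)
Definition christoffel_vec X (y : 'rV[R]_n) p : 'rV[R]_n :=
  \row_k \sum_i \sum_j christoffel c k i j p * X 0 i * y 0 j.

Lemma inner_christoffel_vec X (y z : 'rV[R]_n) p : cdom (matlas c) p ->
  metric c p \in unitmx ->
  inner c (christoffel_vec X y p) z p =
  \sum_a \sum_b \sum_j X 0 a * y 0 b * z 0 j * (2^-1 *
     (pd (matlas c) a (fun q => metric c q b j) p
    + pd (matlas c) b (fun q => metric c q a j) p
    - pd (matlas c) j (fun q => metric c q a b) p)).
Proof.
move=> cp Gu; rewrite innerE exchange_big /=.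
transitivity (\sum_j \sum_a \sum_b \sum_i
   X 0 a * y 0 b * z 0 j * (christoffel c i a b p * metric c p i j)).
  apply: eq_bigr => j _; under [RHS]eq_bigr => a _ do rewrite exchange_big /=.
  rewrite exchange_big /=; apply: eq_bigr => i _; rewrite mxE !mulr_suml.
  apply: eq_bigr => a _; rewrite !mulr_suml; apply: eq_bigr => b _; ring.
rewrite exchange_big /=; apply: eq_bigr => a _.
rewrite exchange_big /=; apply: eq_bigr => b _; apply: eq_bigr => j _.
by rewrite -mulr_sumr christoffel_lower.
Qed.

(** In the two Koszul combinations the derivatives along y and along z occur with opposite signs,
    while the one along X occurs twice and absorbs the factor 1/2. *)
Lemma inner_christoffel_vecD X (y z : 'rV[R]_n) p : cdom (matlas c) p ->
  metric c p \in unitmx ->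
  inner c (christoffel_vec X y p) z p + inner c (christoffel_vec X z p) y p =
  \sum_i \sum_j y 0 i * dvec (matlas c) X (fun q => metric c q i j) p * z 0 j.
Proof.
move=> cp Gu; rewrite !inner_christoffel_vec //.
under [X in _ + X]eq_bigr => a _ do rewrite exchange_big /=.
rewrite -big_split /=.
transitivity (\sum_a \sum_b \sum_j y 0 b * (X 0 a *
   pd (matlas c) a (fun q => metric c q b j) p) * z 0 j).
  apply: eq_bigr => a _; rewrite -big_split; apply: eq_bigr => b _ /=.
  rewrite -big_split; apply: eq_bigr => j _ /=.
  by rewrite (pd_metric_sym j b) // (pd_metric_sym a b) //; field.
rewrite exchange_big; apply: eq_bigr => i _ /=.
rewrite exchange_big; apply: eq_bigr => j _ /=.
by rewrite /dvec mulr_sumr mulr_suml.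
Qed.

Lemma nabla_vecE X Y p :
  nabla_vec c X Y p =
  (\row_k dvec (matlas c) X (fun q => Y q 0 k) p) + christoffel_vec X (Y p) p.
Proof. by apply/rowP => k; rewrite !mxE. Qed.

Lemma innerD X X' (Z : 'rV[R]_n) p :
  inner c (X + X') Z p = inner c X Z p + inner c X' Z p.
Proof. by rewrite /inner !mulmxDl mxE. Qed.

(** The product rule produces derivatives of the components and of the metric;
    [inner_christoffel_vecD] identifies the latter with the Christoffel parts of the two covariant
    derivatives. *)
Lemma nabla_vec_metric X Y Z p : cdom (matlas c) p ->
  metric c p \in unitmx ->
  (forall k, chart_diff (matlas c) (fun q => Y q 0 k) p) ->
  (forall k, chart_diff (matlas c) (fun q => Z q 0 k) p) ->
  dvec (matlas c) X (fun q => inner c (Y q) (Z q) q) p =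
  inner c (nabla_vec c X Y p) (Z p) p + inner c (Y p) (nabla_vec c X Z p) p.
Proof.
move=> cp Gu dY dZ; have dG i j := metric_diff i j cp.
have dYG i j := chart_diffM (dY i) (dG i j).
have dYGZ i j := chart_diffM (dYG i j) (dZ j).
rewrite [X in inner c _ _ _ + X]inner_sym // !nabla_vecE !innerD addrACA.
rewrite inner_christoffel_vecD // [X in _ + X + _]inner_sym // !innerE.
rewrite (_ : (fun q => _) =
    fun q => \sum_i \sum_j Y q 0 i * metric c q i j * Z q 0 j); last first.
  by apply/funext => q; rewrite innerE.
rewrite dvec_sum => [|i]; last by apply: chart_diff_sum => j; exact: dYGZ.
rewrite -!big_split /=; apply: eq_bigr => i _.
rewrite dvec_sum // -!big_split /=; apply: eq_bigr => j _.
by rewrite !dvecM // !mxE; ring.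
Qed.

End Riemannian.

(** * Maps, frames and the spin connection *)

Section MapTheory.
Variables (R : realType) (m n : nat).
Variables (M : riemannian_manifold R m) (N : riemannian_manifold R n).
Variable phi : M -> N.
Implicit Types (c : mindex M) (d : mindex N) (p : M).

Definition dcol c (f : M -> R) p : 'cV[R]_m := \col_i pd (matlas c) i f p.

Lemma dvec_dcol c X f p : dvec (matlas c) X f p = (X *m dcol c f p) 0 0.
Proof. by rewrite mxE; apply: eq_bigr => i _; rewrite mxE. Qed.

Lemma dcol_change_source c c' f p : cdom (matlas c) p -> cdom (matlas c') p ->
  chart_diff (matlas c) f p ->
  dcol c' f p = jacobian (matlas c') (matlas c) p *m dcol c f p.
Proof.
move=> cp c'p df; apply/colP => i; rewrite !mxE.
rewrite (@pd_comp _ _ _ (matlas c') m _ (matlas c) id f) //; last 2 first.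
- exact: cdom_near.
- by move=> j; exact: (smooth_in_diff (@msmooth _ _ M c' c j) (conj c'p cp)).
by apply: eq_bigr => j _; rewrite !mxE.
Qed.

Hypothesis phi_smooth : smooth_map phi.

Definition map_dom c d : set M := cdom (matlas c) `&` phi @^-1` cdom (matlas d).

Lemma preimage_cdom_open d : open (phi @^-1` cdom (matlas d)).
Proof.
case: phi_smooth => cphi _; apply: open_comp => [x _|]; first exact: cphi.
exact: cdom_open.
Qed.

Lemma map_dom_open c d : open (map_dom c d).
Proof. by apply: openI; [exact: cdom_open|exact: preimage_cdom_open]. Qed.

Lemma mapcoord_smooth c d i : smooth_in (matlas c) (map_dom c d) (mapcoord phi d i).
Proof. by case: phi_smooth => _; apply. Qed.

Lemma mapcoord_diff c d i p : cdom (matlas c) p -> cdom (matlas d) (phi p) ->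
  chart_diff (matlas c) (mapcoord phi d i) p.
Proof. by move=> cp dp; exact: (smooth_in_diff (@mapcoord_smooth c d i) (conj cp dp)). Qed.

Lemma dcol_change_target c d d' i p : cdom (matlas c) p ->
  cdom (matlas d) (phi p) -> cdom (matlas d') (phi p) ->
  dcol c (mapcoord phi d i) p =
  \sum_j jacobian (matlas d') (matlas d) (phi p) j i *: dcol c (mapcoord phi d' j) p.
Proof.
move=> cp dp d'p; apply/colP => k; rewrite summxE mxE.
rewrite (@pd_comp _ _ _ (matlas c) n _ (matlas d') phi (chart_coord (matlas d) i)) //.
- by apply: eq_bigr => j _; rewrite !mxE mulrC.
- apply: open_nbhs_nbhs; split; [exact: preimage_cdom_open|exact: d'p].
- by move=> j; exact: mapcoord_diff.
- exact: (smooth_in_diff (@msmooth _ _ N d' d i) (conj d'p dp)).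
Qed.

(** Each of the three terms is symmetric by itself: the second derivatives by [pdC], the other two
    because both Levi-Civita connections are torsion-free. *)
Lemma second_fundamental_form_sym c d i a b p :
  cdom (matlas c) p -> cdom (matlas d) (phi p) ->
  second_fundamental_form phi c d i a b p =
  second_fundamental_form phi c d i b a p.
Proof.
move=> cp dp; pose f := mapcoord phi d i.
have Ef : pd (matlas c) a (pd (matlas c) b f) p = pd (matlas c) b (pd (matlas c) a f) p.
  apply: (pdC (map_dom_open c d) _ _ _ (@mapcoord_smooth c d i)) => [q []|] //.
have EM : \sum_e christoffel c e a b p * pd (matlas c) e f p =
          \sum_e christoffel c e b a p * pd (matlas c) e f p.
  by apply: eq_bigr => e _; rewrite christoffel_sym.
have EN : \sum_j \sum_k christoffel d i j k (phi p)
      * pd (matlas c) a (mapcoord phi d j) p * pd (matlas c) b (mapcoord phi d k) p =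
    \sum_j \sum_k christoffel d i j k (phi p)
      * pd (matlas c) b (mapcoord phi d j) p * pd (matlas c) a (mapcoord phi d k) p.
  rewrite exchange_big; apply: eq_bigr => j _; apply: eq_bigr => k _.
  by rewrite (christoffel_sym i k j dp) mulrAC.
exact: (congr2 +%R (congr2 (fun x y => x - y) Ef EM) EN).
Qed.

Definition sff_mx c d i p : 'M[R]_m :=
  \matrix_(a, b) second_fundamental_form phi c d i a b p.

Lemma sff_mx_tr c d i p : cdom (matlas c) p -> cdom (matlas d) (phi p) ->
  (sff_mx c d i p)^T = sff_mx c d i p.
Proof.
by move=> cp dp; apply/matrixP => a b; rewrite !mxE second_fundamental_form_sym.
Qed.

Lemma tension_trace c d i p : cdom (matlas c) p -> cdom (matlas d) (phi p) ->
  tension phi c d i p = \tr (invmx (metric c p) *m sff_mx c d i p).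
Proof.
move=> cp dp; rewrite -[X in _ *m X]sff_mx_tr //.
by apply: eq_bigr => a _; rewrite mxE; apply: eq_bigr => b _; rewrite !mxE.
Qed.

End MapTheory.

Lemma mul_row_tr_row (R : pzSemiRingType) m n p (A : 'M[R]_(m, n)) (B : 'M_(p, n)) k l :
  (row k A *m (row l B)^T) 0 0 = (A *m B^T) k l.
Proof. by rewrite !mxE; apply: eq_bigr => j _; rewrite !mxE. Qed.

Lemma orthonormal_frameK (R : realType) (G E : 'M[R]_2) :
  orthonormal_frame G E -> E^T *m E *m G = 1%:M.
Proof. by move/mulmx1C; rewrite mulmxA. Qed.

Lemma orthonormal_frame_unit (R : realType) (G E : 'M[R]_2) :
  orthonormal_frame G E -> G \in unitmx.
Proof. by move/orthonormal_frameK/mulmx1_unit => []. Qed.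

(** Turns the trace against the inverse metric that defines [tension] into a trace over the
    frame. *)
Lemma orthonormal_frame_invmx (R : realType) (G E : 'M[R]_2) :
  orthonormal_frame G E -> invmx G = E^T *m E.
Proof.
move=> EG; rewrite -[LHS]mul1mx -(orthonormal_frameK EG).
by rewrite mulmxK // (orthonormal_frame_unit EG).
Qed.

Lemma curvature_antisym (R : realType) n (N : riemannian_manifold R n)
    (d : mindex N) i j k l y :
  curvature d i j k l y = - curvature d i j l k y.
Proof.
rewrite /curvature opprD opprB -sumrN; congr (_ + _).
by apply: eq_bigr => e _; rewrite opprB.
Qed.

(** * The spin connection in a trivialization *)

Section SpinorTheory.
Variables (R : realType) (M : riemann_surface R) (S : spin_structure M).
Variable a : sp_index S.
Local Notation c := (sp_chart a).
Local Notation E := (sp_frame a).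
Implicit Types (p : M) (X : 'rV[R]_2) (xi : M -> 'cV[R[i]]_2).

Lemma sp_dom_near p : sp_dom a p -> \forall q \near p, sp_dom a q.
Proof. by move=> ap; apply: open_nbhs_nbhs; split => //; exact: sp_open. Qed.

Lemma sp_frame_diff p k i : sp_dom a p ->
  chart_diff (matlas c) (fun q => E q k i) p.
Proof. by apply: smooth_in_diff; exact: sp_frame_smooth. Qed.

Lemma cliffE p X : cliff a p X = cvec (X *m metric c p *m (E p)^T).
Proof. exact: cliffordE. Qed.

Lemma cliff_frame p k : sp_dom a p -> cliff a p (row k (E p)) = gamma k.
Proof.
move=> ap; rewrite cliffE -!row_mul (sp_frame_on ap) row1 cvec_delta //.
Qed.

Definition connection_mx X p : 'M[R]_2 := \matrix_(k, l) connection_form a X k l p.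

(** The functions g(e_k, e_l) are constant in a whole neighbourhood of p, so their derivatives
    vanish, and metric compatibility expands these derivatives. *)
Lemma connection_mx_antisym X p : sp_dom a p ->
  (connection_mx X p)^T = - connection_mx X p.
Proof.
move=> ap; have cp := sp_sub ap; apply/matrixP => l k; rewrite !mxE.
apply/eqP; rewrite -addr_eq0 {2}/connection_form inner_sym //.
rewrite -nabla_vec_metric //.
- rewrite (@dvec_near _ _ _ _ _ _ (fun=> (k == l)%:R)) ?dvec_cst //.
  apply: filterS (sp_dom_near ap) => q aq.
  by rewrite /inner -row_mul mul_row_tr_row (sp_frame_on aq) mxE.
- exact: orthonormal_frame_unit (sp_frame_on ap).
- by move=> i; apply: chart_diff_near (sp_frame_diff k i ap);
    [exact: cp|apply: nearW => q; rewrite mxE].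
- by move=> i; apply: chart_diff_near (sp_frame_diff l i ap);
    [exact: cp|apply: nearW => q; rewrite mxE].
Qed.

Lemma nabla_spinE X xi p :
  nabla_spin a X xi p
  = dspinor a X xi p + spin_potential (connection_mx X p) *m xi p.
Proof.
rewrite /nabla_spin /spin_potential -scalemxAl mulmx_suml; congr (_ + _ *: _).
apply: eq_bigr => k _; rewrite mulmx_suml; apply: eq_bigr => l _.
by rewrite -scalemxAl mxE.
Qed.

Lemma dspinor_near X xi xi' p : sp_dom a p ->
  (\forall q \near p, xi q = xi' q) -> dspinor a X xi p = dspinor a X xi' p.
Proof.
move=> ap xixi'; apply/colP => s; rewrite !mxE; congr (_ +i* _);
  apply: dvec_near; try exact: sp_sub; by apply: filterS xixi' => q ->.
Qed.

Definition spinor_diff xi p := forall s,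
  chart_diff (matlas c) (fun q => complex.Re (xi q s 0)) p /\
  chart_diff (matlas c) (fun q => complex.Im (xi q s 0)) p.

(** An ordinary product rule, the gamma matrices being constant; it is checked on real and imaginary
    parts because [dspinor] differentiates them separately. *)
Lemma dspinor_cvec X (w : M -> 'rV[R]_2) xi p : sp_dom a p ->
  (forall k, chart_diff (matlas c) (fun q => w q 0 k) p) -> spinor_diff xi p ->
  dspinor a X (fun q => cvec (w q) *m xi q) p =
  cvec (\row_k dvec (matlas c) X (fun q => w q 0 k) p) *m xi p
  + cvec (w p) *m dspinor a X xi p.
Proof.
move=> ap dw dxi; have cp := sp_sub ap.
have DM k f : chart_diff (matlas c) f p ->
    dvec (matlas c) X (fun q => w q 0 k * f q) p =
    dvec (matlas c) X (fun q => w q 0 k) p * f p + w p 0 k * dvec (matlas c) X f p.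
  exact: dvecM.
have dM k f : chart_diff (matlas c) f p ->
    chart_diff (matlas c) (fun q => w q 0 k * f q) p.
  exact: chart_diffM.
(* Differences are written as sums with a factor -1, so that the rules for sums, products and
   constants suffice. *)
have dN f : chart_diff (matlas c) f p -> chart_diff (matlas c) (fun q => -1 * f q) p.
  by apply: chart_diffM; exact: chart_diff_cst.
have DN f : chart_diff (matlas c) f p ->
    dvec (matlas c) X (fun q => -1 * f q) p = -1 * dvec (matlas c) X f p.
  by move=> df; rewrite dvecM ?dvec_cst ?mul0r ?add0r //; exact: chart_diff_cst.
have [[dr0 di0] [dr1 di1]] := (dxi 0, dxi 1).
apply/colP => s; rewrite !cvec_mul !mxE.
elim/ord2P: s => /=.
  rewrite (_ : (fun q => complex.Re _) = fun q => w q 0 0 * complex.Re (xi q 1 0)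
     + -1 * (w q 0 1 * complex.Im (xi q 1 0))); last first.
    apply/funext => q; rewrite cvec_mul mxE /=; case: (xi q 1 0) => x y /=; ring.
  rewrite (_ : (fun q => complex.Im _) = fun q => w q 0 0 * complex.Im (xi q 1 0)
     + (w q 0 1 * complex.Re (xi q 1 0))); last first.
    apply/funext => q; rewrite cvec_mul mxE /=; case: (xi q 1 0) => x y /=; ring.
  rewrite !dvecD ?DN ?DM; do ?[exact: dr1|exact: di1|apply: dM|apply: dN].
  move: (xi p 1 0) => [x y] /=.
  by apply/eqP; rewrite eq_complex /=; apply/andP; split; apply/eqP; ring.
rewrite (_ : (fun q => complex.Re _) = fun q => -1 * (w q 0 0 * complex.Re (xi q 0 0))
     + -1 * (w q 0 1 * complex.Im (xi q 0 0))); last first.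
  apply/funext => q; rewrite cvec_mul mxE /=; case: (xi q 0 0) => x y /=; ring.
rewrite (_ : (fun q => complex.Im _) = fun q => -1 * (w q 0 0 * complex.Im (xi q 0 0))
     + (w q 0 1 * complex.Re (xi q 0 0))); last first.
  apply/funext => q; rewrite cvec_mul mxE /=; case: (xi q 0 0) => x y /=; ring.
rewrite !dvecD ?DN ?DM; do ?[exact: dr0|exact: di0|apply: dM|apply: dN].
move: (xi p 0 0) => [x y] /=.
by apply/eqP; rewrite eq_complex /=; apply/andP; split; apply/eqP; ring.
Qed.

Lemma nabla_spin_near X xi xi' p : sp_dom a p ->
  (\forall q \near p, xi q = xi' q) ->
  nabla_spin a X xi p = nabla_spin a X xi' p.
Proof.
move=> ap xixi'; rewrite !nabla_spinE (dspinor_near X ap xixi').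
by rewrite (nbhs_singleton xixi').
Qed.

(** The commutator of the potential with the Clifford factor supplies [w p *m connection_mx X p],
    which completes the derivatives of the components to the covariant derivative of w in the
    frame. *)
Lemma nabla_spin_cvec X (w : M -> 'rV[R]_2) xi p : sp_dom a p ->
  (forall k, chart_diff (matlas c) (fun q => w q 0 k) p) -> spinor_diff xi p ->
  nabla_spin a X (fun q => cvec (w q) *m xi q) p =
  cvec (w p) *m nabla_spin a X xi p
  + cvec ((\row_k dvec (matlas c) X (fun q => w q 0 k) p)
          + w p *m connection_mx X p) *m xi p.
Proof.
move=> ap dw dxi; rewrite !nabla_spinE dspinor_cvec // mulmxA.
rewrite spin_potential_cvec ?connection_mx_antisym //.
by rewrite cvecD !mulmxDr !mulmxDl !mulmxA; rewrite [X in X + _ = _]addrC addrACA.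
Qed.

End SpinorTheory.

(** * Gradient and Hessian in the orthonormal frame *)

Section SpinorTheory.
Variables (R : realType) (M : riemann_surface R) (S : spin_structure M).
Variable a : sp_index S.
Local Notation c := (sp_chart a).
Local Notation E := (sp_frame a).
Implicit Types (p : M) (X : 'rV[R]_2) (xi : M -> 'cV[R[i]]_2).

(** The derivatives e_k f, which are the frame components of the gradient because the frame is
    orthonormal. *)
Definition frame_grad (f : M -> R) p : 'rV[R]_2 := (E p *m dcol c f p)^T.

Lemma frame_expansion f p (V : 'rV[R]_2) : sp_dom a p ->
  \sum_k inner c V (row k (E p)) p * frame_grad f p 0 k = dvec (matlas c) V f p.
Proof.
move=> ap; have Gi := orthonormal_frameK (sp_frame_on ap).
have := mulmx1C Gi; rewrite mulmxA dvec_dcol => GE.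
rewrite -[V in RHS]mulmx1 -GE -!mulmxA 2!mulmxA mxE.
apply: eq_bigr => k _; congr (_ * _); last by rewrite /frame_grad [LHS]mxE.
by rewrite /inner -{1}(row_id 0 (V *m _)) mul_row_tr_row.
Qed.

Definition hessian_mx (f : M -> R) p : 'M[R]_2 := \matrix_(i, j)
  (pd (matlas c) i (pd (matlas c) j f) p
   - \sum_e christoffel c e i j p * pd (matlas c) e f p).

Lemma frame_grad_diff f p k : sp_dom a p ->
  (forall i, chart_diff (matlas c) (pd (matlas c) i f) p) ->
  chart_diff (matlas c) (fun q => frame_grad f q 0 k) p.
Proof.
move=> ap df; apply: (@chart_diff_near _ _ _ _
    (fun q => \sum_i E q k i * pd (matlas c) i f q)); first exact: sp_sub.
  by apply: nearW => q; rewrite !mxE; apply: eq_bigr => i _; rewrite mxE.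
by apply: chart_diff_sum => i; apply: chart_diffM => //; exact: sp_frame_diff.
Qed.

(** This is X (e_k f) - (nabla_X e_k) f = (nabla_X df)(e_k): antisymmetry of the connection matrix
    makes the second summand the derivative of f along - nabla_X e_k. *)
Lemma frame_grad_derivative X f p : sp_dom a p ->
  (forall i, chart_diff (matlas c) (pd (matlas c) i f) p) ->
  (\row_k dvec (matlas c) X (fun q => frame_grad f q 0 k) p)
  + frame_grad f p *m connection_mx a X p
  = X *m hessian_mx f p *m (E p)^T.
Proof.
move=> ap df; have cp := sp_sub ap; apply/rowP => k.
rewrite [LHS]mxE [X in X + _]mxE [X in _ + X]mxE.
have -> : \sum_l frame_grad f p 0 l * connection_mx a X p l k
   = - dvec (matlas c) (nabla_vec c X (fun q => row k (E q)) p) f p.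
  rewrite -frame_expansion // -sumrN; apply: eq_bigr => l _.
  have /matrixP/(_ k l) := connection_mx_antisym X ap; rewrite !mxE => ->.
  by rewrite mulrN mulrC.
rewrite (_ : (fun q => _) = fun q => \sum_i E q k i * pd (matlas c) i f q); last first.
  by apply/funext => q; rewrite !mxE; apply: eq_bigr => i _; rewrite mxE.
rewrite dvec_sum => [|i]; last by apply: chart_diffM => //; exact: sp_frame_diff.
have Erow j : (fun q => row k (E q) 0 j) = fun q => E q k j.
  by apply/funext => q; rewrite mxE.
(* The derivatives of the frame entries occur in both X (e_k f) and (nabla_X e_k) f and cancel. *)
transitivity (\sum_j E p k j * dvec (matlas c) X (pd (matlas c) j f) p
  - \sum_j \sum_i \sum_l christoffel c j i l p * X 0 i * E p k l * pd (matlas c) j f p).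
  rewrite /dvec -!sumrB; apply: eq_bigr => j _.
  rewrite -![\sum_i X 0 i * _]/(dvec (matlas c) X _ p) dvecM //; last exact: sp_frame_diff.
  rewrite mxE Erow mulrDl mulr_suml [X in X - _]addrC opprD addrA addrK.
  congr (_ - _); rewrite mulr_suml; apply: eq_bigr => i _.
  by rewrite mulr_suml; apply: eq_bigr => l _; rewrite mxE.
rewrite [X in _ - X]exchange_big /=.
under [X in _ - X]eq_bigr => i _ do rewrite exchange_big /=.
rewrite [X in _ - X]exchange_big /= -sumrB [RHS]mxE; apply: eq_bigr => l _.
rewrite [(X *m _) 0 l]mxE [_^T l k]mxE mulr_suml /dvec mulr_sumr -sumrB.
apply: eq_bigr => i _; rewrite mxE mulrBr mulrBl; congr (_ - _); first by ring.
by rewrite mulr_sumr mulr_suml; apply: eq_bigr => e _; ring.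
Qed.

End SpinorTheory.

(** * The spinor along phi as a global smooth section *)

Section TwistedSpinors.
Variables (R : realType) (M : riemann_surface R) (S : spin_structure M).
Variables (n : nat) (N : riemannian_manifold R n) (phi : M -> N).
Implicit Types (a : sp_index S) (d : mindex N) (i : 'I_n) (p : M).
Hypothesis phi_smooth : smooth_map phi.
Variable Psi : sp_index S -> M -> 'cV[R[i]]_2.
Hypothesis Psi_spinor : is_spinor Psi.

Definition spin_dom a d : set M := sp_dom a `&` phi @^-1` cdom (matlas d).

Lemma spin_dom_open a d : open (spin_dom a d).
Proof. by apply: openI; [exact: sp_open|exact: preimage_cdom_open]. Qed.

Lemma spin_dom_map_dom a d : spin_dom a d `<=` map_dom phi (sp_chart a) d.
Proof. by move=> p [/sp_sub]. Qed.

Lemma spin_dom_cdom a d : spin_dom a d `<=` cdom (matlas (sp_chart a)).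
Proof. by move=> p [/sp_sub]. Qed.

Definition frame_deriv a d i p := frame_grad a (mapcoord phi d i) p.

(* The right-hand side does not involve eps because
   \sum_k eps_k (x) eps_k is the inverse metric for every orthonormal frame. *)
Lemma spinor_alongE (eps : sp_index S -> M -> 'M[R]_2) a d i p :
  sp_dom a p -> orthonormal_frame (metric (sp_chart a) p) (eps a p) ->
  spinor_along phi eps Psi a d i p = cvec (frame_deriv a d i p) *m Psi a p.
Proof.
move=> ap epso; rewrite /spinor_along.
under eq_bigr => k _.
  rewrite cliffE scalemxAl -cvecZ dvec_dcol -row_mul mxE.
  rewrite 2!scalemxAl; over.
rewrite -mulmx_suml -cvec_sum -!mulmx_suml /frame_deriv /frame_grad.
set u := eps a p *m _.
have -> : \sum_k u k 0 *: row k (eps a p) = u^T *m eps a p.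
  by rewrite [RHS]mulmx_sum_row; apply: eq_bigr => k _; rewrite [_^T _ _]mxE.
rewrite /u !trmx_mul -!(mulmxA (dcol _ _ _)^T).
by rewrite (orthonormal_frameK epso) mul1mx.
Qed.

Lemma pd_mapcoord_smooth a d i k :
  smooth_in (matlas (sp_chart a)) (spin_dom a d)
    (pd (matlas (sp_chart a)) k (mapcoord phi d i)).
Proof.
apply: smooth_in_pd; [exact: spin_dom_open|exact: spin_dom_cdom|].
apply: smooth_in_subset (@spin_dom_map_dom a d) _.
exact: (@mapcoord_smooth _ _ _ _ _ _ phi_smooth).
Qed.

Lemma frame_deriv_smooth a d i k :
  smooth_in (matlas (sp_chart a)) (spin_dom a d) (fun p => frame_deriv a d i p 0 k).
Proof.
have oU := spin_dom_open a d; have Uc := @spin_dom_cdom a d.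
apply: (smooth_in_eq oU Uc (f := fun p => \sum_l sp_frame a p k l
    * pd (matlas (sp_chart a)) l (mapcoord phi d i) p)).
  by move=> p _; rewrite !mxE; apply: eq_bigr => l _; rewrite mxE.
apply: smooth_in_sum => // l; apply: smooth_inM => //.
  apply: (@smooth_in_subset _ _ _ _ _ (sp_dom a)); first by move=> p [].
  exact: sp_frame_smooth.
exact: pd_mapcoord_smooth.
Qed.

Lemma cvec_smooth_inC a d (w : M -> 'rV[R]_2) (xi : M -> 'cV[R[i]]_2) r :
  (forall k, smooth_in (matlas (sp_chart a)) (spin_dom a d) (fun p => w p 0 k)) ->
  (forall s, smooth_inC (matlas (sp_chart a)) (spin_dom a d) (fun p => xi p s 0)) ->
  smooth_inC (matlas (sp_chart a)) (spin_dom a d) (fun p => (cvec (w p) *m xi p) r 0).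
Proof.
move=> sw sxi; have oU := spin_dom_open a d; have Uc := @spin_dom_cdom a d.
have sm k (f : M -> R) : smooth_in (matlas (sp_chart a)) (spin_dom a d) f ->
    smooth_in (matlas (sp_chart a)) (spin_dom a d) (fun p => w p 0 k * f p).
  exact: smooth_inM.
have sn (f : M -> R) : smooth_in (matlas (sp_chart a)) (spin_dom a d) f ->
    smooth_in (matlas (sp_chart a)) (spin_dom a d) (fun p => -1 * f p).
  by apply: smooth_inM => //; exact: smooth_in_cst.
have [[r0 i0] [r1 i1]] := (sxi 0, sxi 1).
elim/ord2P: r; split.
- apply: (smooth_in_eq oU Uc (f := fun q => w q 0 0 * complex.Re (xi q 1 0)
     + -1 * (w q 0 1 * complex.Im (xi q 1 0)))).
    move=> q _; rewrite cvec_mul mxE /=; case: (xi q 1 0) => x y /=; ring.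
  by apply: smooth_inD => //; [exact: sm|apply/sn/sm].
- apply: (smooth_in_eq oU Uc (f := fun q => w q 0 0 * complex.Im (xi q 1 0)
     + (w q 0 1 * complex.Re (xi q 1 0)))).
    move=> q _; rewrite cvec_mul mxE /=; case: (xi q 1 0) => x y /=; ring.
  by apply: smooth_inD => //; exact: sm.
- apply: (smooth_in_eq oU Uc (f := fun q => -1 * (w q 0 0 * complex.Re (xi q 0 0))
     + -1 * (w q 0 1 * complex.Im (xi q 0 0)))).
    move=> q _; rewrite cvec_mul mxE /=; case: (xi q 0 0) => x y /=; ring.
  by apply: smooth_inD => //; apply/sn/sm.
- apply: (smooth_in_eq oU Uc (f := fun q => -1 * (w q 0 0 * complex.Im (xi q 0 0))
     + (w q 0 1 * complex.Re (xi q 0 0)))).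
    move=> q _; rewrite cvec_mul mxE /=; case: (xi q 0 0) => x y /=; ring.
  by apply: smooth_inD => //; [apply/sn/sm|exact: sm].
Qed.

Lemma frame_deriv_target a d d' i p : sp_dom a p ->
  cdom (matlas d) (phi p) -> cdom (matlas d') (phi p) ->
  frame_deriv a d i p =
  \sum_j jacobian (matlas d') (matlas d) (phi p) j i *: frame_deriv a d' j p.
Proof.
move=> ap dp d'p; rewrite /frame_deriv /frame_grad.
rewrite (dcol_change_target phi_smooth i (sp_sub ap) dp d'p).
rewrite mulmx_sumr [LHS]raddf_sum; apply: eq_bigr => j _ /=.
by rewrite -scalemxAr [LHS]linearZ.
Qed.

(** [sp_lift] is this relation for the vectors of the frame of a', and both sides are linear in
    w. *)
Lemma sp_trans_cvec a a' w p : sp_dom a p -> sp_dom a' p ->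
  sp_trans a a' p *m cvec w =
  cvec (w *m sp_frame a' p *m jacobian (matlas (sp_chart a')) (matlas (sp_chart a)) p
        *m metric (sp_chart a) p *m (sp_frame a p)^T) *m sp_trans a a' p.
Proof.
move=> ap a'p; set J := jacobian _ _ p; set G := metric _ p.
have -> : w *m sp_frame a' p *m J *m G *m (sp_frame a p)^T =
    \sum_k w 0 k *: (row k (sp_frame a' p) *m J *m G *m (sp_frame a p)^T).
  rewrite [w *m _]mulmx_sum_row !mulmx_suml.
  by apply: eq_bigr => k _; rewrite -!scalemxAl.
rewrite cvec_sum mulmx_suml mulmx_sumr; apply: eq_bigr => k _.
by rewrite -scalemxAr (sp_lift ap a'p) cliffordE cvecZ scalemxAl.
Qed.

(** The gradient does not depend on the frame, so its components in the two frames correspond under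
    the rotation that [sp_trans] covers. *)
Lemma frame_deriv_trans a a' d i p : sp_dom a p -> sp_dom a' p ->
  cdom (matlas d) (phi p) ->
  sp_trans a a' p *m cvec (frame_deriv a' d i p) =
  cvec (frame_deriv a d i p) *m sp_trans a a' p.
Proof.
move=> ap a'p dp; rewrite sp_trans_cvec //; congr (cvec _ *m _).
have cp := sp_sub ap; have c'p := sp_sub a'p.
rewrite /frame_deriv /frame_grad (@dcol_change_source _ _ _ (sp_chart a)) //; last first.
  exact: mapcoord_diff.
set J := jacobian _ _ p; set E' := sp_frame a' p.
(* Rewritten in the chart of a, the frame of a' is still orthonormal, so its Gram product with the
   metric collapses to the identity. *)
have E'J : orthonormal_frame (metric (sp_chart a) p) (E' *m J).
  have := sp_frame_on a'p; rewrite /orthonormal_frame (metric_change c'p cp).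
  by rewrite trmx_mul !mulmxA.
rewrite [E' *m _]mulmxA trmx_mul -![_ *m E' *m J]mulmxA.
rewrite -!(mulmxA (dcol _ _ _)^T) (orthonormal_frameK E'J).
by rewrite mul1mx trmx_mul.
Qed.

(** The transition law splits into a change of target chart, which affects [frame_deriv] alone, and
    a change of trivialization, in which [sp_trans] is moved past the Clifford factor. *)
Lemma spinor_along_frame_twisted :
  is_twisted_spinor phi (fun a d i p => cvec (frame_deriv a d i p) *m Psi a p).
Proof.
case: Psi_spinor => sPsi tPsi; split.
  move=> a d i r; apply: cvec_smooth_inC => [k|s]; first exact: frame_deriv_smooth.
  by have [sr si] := sPsi a s; split;
    [apply: smooth_in_subset sr|apply: smooth_in_subset si] => p [].
move=> a a' d d' i p ap a'p dp d'p.
rewrite (frame_deriv_target i ap dp d'p) cvec_sum mulmx_suml.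
apply: eq_bigr => j _; rewrite cvecZ -scalemxAl; congr (_ *: _).
by rewrite mulmxA frame_deriv_trans // (tPsi _ _ _ ap a'p) mulmxA.
Qed.

End TwistedSpinors.

(** * The Dirac operator along phi *)

Section DiracHarmonic.
Variables (R : realType) (M : riemann_surface R) (S : spin_structure M).
Variables (n : nat) (N : riemannian_manifold R n) (phi : M -> N).
Implicit Types (a : sp_index S) (d : mindex N) (i : 'I_n) (p : M).
Hypothesis phi_smooth : smooth_map phi.
Variable Psi : sp_index S -> M -> 'cV[R[i]]_2.

(** A covariant derivative depends only on germs. This is what is available for [spinor_along],
    whose frame expression is known on the open set [sp_dom a] alone. *)
Lemma nabla_twisted_near a d (psi psi' : 'I_n -> M -> 'cV[R[i]]_2) X i p :
  sp_dom a p -> (forall j, \forall q \near p, psi j q = psi' j q) ->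
  nabla_twisted phi a d psi X i p = nabla_twisted phi a d psi' X i p.
Proof.
move=> ap E; rewrite /nabla_twisted (nabla_spin_near X ap (E i)); congr (_ + _).
apply: eq_bigr => j _; apply: eq_bigr => k _; congr (_ *: _).
exact: nbhs_singleton (E k).
Qed.

Lemma sff_mxE a d i p :
  sff_mx phi (sp_chart a) d i p = hessian_mx a (mapcoord phi d i) p
  + \sum_j \sum_k christoffel d i j k (phi p) *:
      (dcol (sp_chart a) (mapcoord phi d j) p
       *m (dcol (sp_chart a) (mapcoord phi d k) p)^T).
Proof.
apply/matrixP => x y; rewrite !mxE summxE; congr (_ + _).
apply: eq_bigr => j _; rewrite summxE; apply: eq_bigr => k _.
by rewrite !mxE big_ord1 !mxE mulrA.
Qed.

(** [frame_grad_derivative] contributes the Hessian of phi^i on M and the pulled-back connection the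
    Christoffel terms of N; together they form [sff_mx]. *)
Lemma nabla_twisted_frame a d X i p : is_spinor Psi ->
  sp_dom a p -> cdom (matlas d) (phi p) ->
  nabla_twisted phi a d (fun j q => cvec (frame_deriv phi a d j q) *m Psi a q) X i p =
  cvec (frame_deriv phi a d i p) *m nabla_spin a X (Psi a) p
  + cvec (X *m sff_mx phi (sp_chart a) d i p *m (sp_frame a p)^T) *m Psi a p.
Proof.
move=> [sPsi _] ap dp; have cp := sp_sub ap.
have dpd k : chart_diff (matlas (sp_chart a))
    (pd (matlas (sp_chart a)) k (mapcoord phi d i)) p.
  exact: (smooth_in_diff (@pd_mapcoord_smooth _ _ _ _ _ _ phi_smooth a d i k) (conj ap dp)).
rewrite /nabla_twisted nabla_spin_cvec //; last 2 first.
- by move=> k; exact: frame_grad_diff.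
- by move=> s; have [sr si] := sPsi a s; split;
    [exact: smooth_in_diff sr ap|exact: smooth_in_diff si ap].
rewrite frame_grad_derivative // -addrA; congr (_ + _).
rewrite sff_mxE mulmxDr mulmxDl cvecD mulmxDl; congr (_ + _).
have -> : X *m (\sum_j \sum_k christoffel d i j k (phi p) *:
      (dcol (sp_chart a) (mapcoord phi d j) p
       *m (dcol (sp_chart a) (mapcoord phi d k) p)^T)) *m (sp_frame a p)^T =
    \sum_j \sum_k (christoffel d i j k (phi p)
      * dvec (matlas (sp_chart a)) X (mapcoord phi d j) p) *: frame_deriv phi a d k p.
  rewrite mulmx_sumr mulmx_suml; apply: eq_bigr => j _.
  rewrite mulmx_sumr mulmx_suml; apply: eq_bigr => k _.
  rewrite -scalemxAr -scalemxAl -scalerA; congr (_ *: _).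
  rewrite dvec_dcol /frame_deriv /frame_grad trmx_mul mulmxA -(mulmxA _ _^T).
  by rewrite [X *m _ in LHS]mx11_scalar mul_scalar_mx.
rewrite cvec_sum mulmx_suml; apply: eq_bigr => j _.
rewrite cvec_sum mulmx_suml; apply: eq_bigr => k _.
by rewrite cvecZ -scalemxAl.
Qed.

Lemma dirac_along_frame a d i p : twistor_spinor Psi ->
  sp_dom a p -> cdom (matlas d) (phi p) -> tension phi (sp_chart a) d i p = 0 ->
  dirac_along phi a d (fun j q => cvec (frame_deriv phi a d j q) *m Psi a q) i p = 0.
Proof.
move=> [spPsi twPsi] ap dp ten0; have cp := sp_sub ap.
pose w := frame_deriv phi a d i p; pose chi := dirac a (Psi a) p.
pose E := sp_frame a p; pose H := E *m sff_mx phi (sp_chart a) d i p *m E^T.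
transitivity (- (2^-1 *: ((\sum_k gamma k *m cvec w *m gamma k) *m chi))
   + (\sum_k gamma k *m cvec (row k H)) *m Psi a p).
  rewrite mulmx_suml scaler_sumr -sumrN mulmx_suml -big_split /=.
  apply: eq_bigr => k _; rewrite cliff_frame // nabla_twisted_frame // mulmxDr.
  congr (_ + _); last by rewrite mulmxA !row_mul.
  have /eqP := twPsi a p ap (row k E); rewrite addr_eq0 cliff_frame // => /eqP->.
  by rewrite !mulmxN -!scalemxAr !mulmxA.
rewrite gamma_sandwich mul0mx scaler0 oppr0 add0r gamma_trace; last first.
  by rewrite /H !trmx_mul trmxK sff_mx_tr // mulmxA.
(* By cyclicity of the trace the two frame factors of H combine to the inverse metric, which gives
   the tension. *)
rewrite /H mxtrace_mulC mulmxA -(orthonormal_frame_invmx (sp_frame_on ap)).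
by rewrite -tension_trace // ten0 oppr0 raddf0 mul0mx.
Qed.

Lemma sum_antisym (V : numDomainType) m (F : 'I_m -> 'I_m -> V) :
  (forall k l, F k l = - F l k) -> \sum_k \sum_l F k l = 0.
Proof.
move=> Fa; set s := \sum_k _; have /eqP : s = - s.
  rewrite {1}/s exchange_big -sumrN; apply: eq_bigr => k _.
  by rewrite -sumrN; apply: eq_bigr => l _.
by rewrite -addr_eq0 -mulr2n mulrn_eq0 => /eqP.
Qed.

(** The term is algebraic in psi, so values at p suffice. It vanishes as a complex number,
    separately for each j. *)
Lemma curvature_term_frame a d (psi : 'I_n -> M -> 'cV[R[i]]_2) i p :
  (forall j, psi j p = cvec (frame_deriv phi a d j p) *m Psi a p) ->
  curvature_term phi a d psi i p = 0.
Proof.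
move=> psiE; rewrite /curvature_term big1 ?mulr0 // => j _.
apply: sum_antisym => k l.
have -> : hdot (psi k p) (cliff a p (gradient (sp_chart a) (mapcoord phi d j) p) *m psi l p)
        = hdot (psi l p) (cliff a p (gradient (sp_chart a) (mapcoord phi d j) p) *m psi k p).
  by rewrite (psiE k) (psiE l) cliffE; exact: hdot_cvec_sym.
by rewrite (curvature_antisym d i j k l) rmorphN mulNr.
Qed.

End DiracHarmonic.

Theorem theorem2 (R : realType) (M : riemann_surface R) (S : spin_structure M)
    (n : nat) (N : riemannian_manifold R n) (phi : M -> N)
    (Psi : sp_index S -> M -> 'cV[R[i]]_2)
    (eps : sp_index S -> M -> 'M[R]_2) :
  harmonic_map phi ->
  twistor_spinor Psi ->
  (forall (a : sp_index S) (p : M), sp_dom a p ->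
     orthonormal_frame (metric (sp_chart a) p) (eps a p)) ->
  dirac_harmonic phi (spinor_along phi eps Psi).
Proof.
move=> [sphi harm] twPsi oneps; have spPsi := twPsi.1.
have psiE a d i p : sp_dom a p -> spinor_along phi eps Psi a d i p =
    cvec (frame_deriv phi a d i p) *m Psi a p.
  by move=> ap; apply: spinor_alongE => //; exact: oneps.
have [sfr tfr] := spinor_along_frame_twisted sphi spPsi.
split=> //; first split.
- move=> a d i r; have [sr si] := sfr a d i r.
  split; [move: sr|move: si]; apply: smooth_in_eq;
    try exact: spin_dom_open; try exact: spin_dom_cdom; by move=> p [ap _]; rewrite psiE.
- move=> a a' d d' i p ap a'p dp d'p; rewrite psiE // (tfr a a' d d') //.
  by apply: eq_bigr => j _; rewrite psiE.
move=> a d i p ap dp; split.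
  rewrite harm //; last exact: sp_sub.
  by rewrite (curvature_term_frame (Psi := Psi)) // => j; exact: psiE.
transitivity (dirac_along phi a d (fun j q => cvec (frame_deriv phi a d j q) *m Psi a q) i p).
  apply: eq_bigr => k _; congr (_ *m _); apply: nabla_twisted_near => // j.
  by apply: filterS (sp_dom_near ap) => q aq; exact: psiE.
by apply: dirac_along_frame => //; apply: harm => //; exact: sp_sub.
Qed.
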